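(* For every $k\in\mathbb N$ there are constants $C_1(k),C_2(k)>0$, depending only on $k$, such that for all $n,d\in\mathbb N$ and every $f\in\mathcal P_d(\mathbb R^n)$ one has \[ \Bigl(\int_{[-1,1]^n}\Bigl(\sum_{j=1}^n(1-x_j^2)(\partial_{x_j}f)^2\Bigr)^k\,dx\Bigr)^{\frac1{2k}}\le C_1(k)\,d\,\|f\|_{L^{2k}([-1,1]^n)} \] and \[ \|\nabla f\|_{L^{2k}([-1,1]^n)}\le C_2(k)\,d^2\,\|f\|_{L^{2k}([-1,1]^n)}. \] One may take $C_1(1)=\sqrt2$, $C_2(1)=12$, and $C_1(k)=46k^2$, $C_2(k)=368k^3$ for $k\ge2$.
   Context: $\mathbb N=\{1,2,\dots\}$. $\mathcal P_d(\mathbb R^n)$ is the space of all real algebraic polynomials in $n$ variables of (total) degree at most $d$. $L^{2k}([-1,1]^n)$ is taken with respect to Lebesgue measure $dx$, and $\|\nabla f\|_{L^{2k}}$ is the $L^{2k}$ norm of the Euclidean length $|\nabla f|$. *)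

(* Defs.v *)
From HB Require Import structures.
From mathcomp Require Import all_boot all_order all_algebra.
(* The notations of mpoly clash with those of MathComp-Analysis. *)
From mathcomp Require Import -(notations) mpoly.
From mathcomp Require Import all_classical all_reals all_analysis.

Set Implicit Arguments.
Unset Strict Implicit.
Unset Printing Implicit Defensive.
Import Order.TTheory GRing.Theory Num.Theory.
Import numFieldNormedType.Exports.

Local Open Scope classical_set_scope.
Local Open Scope ring_scope.
Local Open Scope ereal_scope.

Section lebesgue_tuple.
Context {R : realType}.

Definition cons_pair n (p : n.-tuple (measurableTypeR R) * measurableTypeR R) :
    n.+1.-tuple (measurableTypeR R) := [tuple of p.2 :: p.1].

Lemma measurable_cons_pair n : measurable_fun [set: _] (@cons_pair n).
Proof. exact: (measurable_cons measurable_snd measurable_fst). Qed.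

Definition lebesgue_cons n
    (mu : {measure set (n.-tuple (measurableTypeR R)) -> \bar R}) :=
  pushforward (mu \x lebesgue_measure) (@cons_pair n).

HB.instance Definition _ n mu := Measure.copy (@lebesgue_cons n mu)
  (measure_function_pushforward__canonical__measure_function_Measure
    (mu \x lebesgue_measure) (@measurable_cons_pair n)).

Fixpoint lebesgue_tuple n :
    {measure set (n.-tuple (measurableTypeR R)) -> \bar R} :=
  match n with
  | 0%N => \d_([tuple] : 0.-tuple (measurableTypeR R))
  | m.+1 => lebesgue_cons (lebesgue_tuple m)
  end.

Lemma lebesgue_tuple_box n (A : 'I_n -> set (measurableTypeR R)) :
  (forall i, measurable (A i)) ->
  lebesgue_tuple n [set x | forall i, A i (tnth x i)] =
  \prod_(i < n) lebesgue_measure (A i).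
Proof.
elim: n A => [|n IH] A mA.
  rewrite big_ord0 /= diracE (_ : _ \in _ = true)//.
  by apply/mem_set => -[].
rewrite big_ord_recl /= /lebesgue_cons /pushforward.
rewrite (_ : _ @^-1` _ =
  [set x | forall i, A (lift ord0 i) (tnth x i)] `*` A ord0).
  rewrite product_measure1E//; last first.
    rewrite [X in measurable X](_ : _ =
      \bigcap_(i in [set: 'I_n])
        ((fun x => tnth x i) @^-1` A (lift ord0 i))).
      apply: fin_bigcap_measurable => // i _.
      by rewrite -[X in measurable X]setTI; exact: measurable_tnth.
    by apply/seteqP; split => x /= h i; [move=> _|]; exact: h.
  by rewrite muleC (IH (fun i => A (lift ord0 i))).
apply/seteqP; split => -[x y] /= h.
  split => [i|]; last exact: (h ord0).
  by have := h (lift ord0 i); rewrite tnthS.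
move=> i; case: (unliftP ord0 i) => [j ->|->]; last exact: h.2.
by rewrite tnthS; exact: h.1.
Qed.

End lebesgue_tuple.

Local Close Scope ereal_scope.

Definition cube (R : realType) n : set (n.-tuple (measurableTypeR R)) :=
  [set x | forall i, tnth x i \in `[-1, 1]].
Arguments cube R n : clear implicits.

Lemma measurable_cube (R : realType) n : measurable (cube R n).
Proof.
rewrite [X in measurable X](_ : _ =
    \bigcap_(i in [set: 'I_n])
      ((fun x => tnth x i) @^-1` [set` `[-1, 1]])).
  apply: fin_bigcap_measurable => // i _.
  rewrite -[X in measurable X]setTI.
  by apply: measurable_tnth => //; exact: measurable_itv.
by apply/seteqP; split => x /= h i; [move=> _|]; exact: h.
Qed.

(* The norm of L^p([-1, 1]^n): f is cut off to 0 outside the cube. *)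
Definition cube_Lnorm (R : realType) n (p : \bar R)
    (f : n.-tuple (measurableTypeR R) -> R) : \bar R :=
  'N[lebesgue_tuple n]_p[(EFin \o f) \_ (cube R n)]%E.

Definition peval (R : realType) n (f : mpoly n R)
    (x : n.-tuple (measurableTypeR R)) : R := meval (tnth x) f.

(* [msize] is the total degree plus one, and 0 for the zero polynomial. *)
Definition poly_space (R : realType) d n : set (mpoly n R) :=
  [set f | (msize f <= d.+1)%N].
Arguments poly_space R d n : clear implicits.

Definition grad_norm (R : realType) n (f : mpoly n R)
    (x : n.-tuple (measurableTypeR R)) : R :=
  Num.sqrt (\sum_(j < n) peval (mderiv j f) x ^+ 2).

Definition weighted_sqgrad (R : realType) n (f : mpoly n R)
    (x : n.-tuple (measurableTypeR R)) : R :=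
  \sum_(j < n) (1 - tnth x j ^+ 2) * peval (mderiv j f) x ^+ 2.

(* Main.v *)
Require Import Defs.
From HB Require Import structures.
From mathcomp Require Import all_boot all_order all_algebra.
From mathcomp Require Import -(notations) mpoly.
From mathcomp Require Import all_classical all_reals all_analysis.
From mathcomp Require Import measurable_realfun.
From mathcomp Require Import ring lra zify.
Set Implicit Arguments.
Unset Strict Implicit.
Unset Printing Implicit Defensive.
Import Order.TTheory GRing.Theory Num.Theory.
Import numFieldNormedType.Exports.
Local Open Scope classical_set_scope.
Local Open Scope ring_scope.

(** Let [(x_j, y_j)], [j < n], be the projections to a coordinate plane of [n]
    independent uniform points of the unit sphere in 3-space.  By Archimedes'
    theorem each [x_j] is uniform on [[-1, 1]], so integrals over the cube are
    expectations of functions of [x]; given [x], the [y_j] are independent,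
    centred, of variance [(1 - x_j^2) / 2].  Rotating all the planes by one
    common angle [t] preserves the joint law, and along such a rotation a
    polynomial [f] of total degree at most [d] becomes a trigonometric polynomial
    of degree at most [d] in [t], whose derivative at [t = 0] is
    [V = \sum_j y_j (d_j f)(x)].

    Bernstein's inequality then costs no dependence on [n].  M. Riesz's formula
    ([riesz_interpolation]) writes [V] as a combination of values of [f] along the
    rotation, with coefficients of total absolute mass [d]
    ([sum_norm_riesz_weight]); convexity of the power [2k] ([weighted_sum_pow]) and
    rotation invariance ([expect_rot]) give [E V^2k <= d^2k E f^2k].  On the other
    side, [G = \sum_j (1 - x_j^2) (d_j f)^2] satisfies
    [E ((G/2)^(k-1) V^2) = E (G/2)^k] by the conditional second moments
    ([expect_xyy]), so [E (G/2)^k <= E V^2k] by Young's inequality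
    [k a^(k-1) b <= (k-1) a^k + b^k].  Hence
    [\int G^k <= (2 d^2)^k \int f^2k] for every [k] ([bernstein_cube]), that is,
    the constant [sqrt 2], below [46 k^2].

    For Markov's inequality only the weight [1 - x_j^2] has to be removed.
    Integrating the [j]-th derivative of [(1 - x_j^2) x_j p^2] and using
    Bernstein's inequality with [k = 1] for [p] gives
    [\int p^2 <= (3 + 2 N^2) \int (1 - x_j^2) p^2] when [deg p <= N]
    ([pint_le_weighted]).  With [F = \sum_i (d_i f)^2], the integrand
    [(d_j f)^2 F^(k-1)] is a sum of squares of polynomials of degree at most
    [k (d-1)], so the same bound holds for it with [N = k d]; summing over [j],
    [\int F^k <= C \int G F^(k-1)] with [C <= 5 (k d)^2], and Young's inequality
    again yields [\int F^k <= C^k \int G^k] ([markov_cube]).  The resulting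
    constant [sqrt 10 k] is below [12] for [k = 1] and below [368 k^3] otherwise.

    The random point is realized as [(x_j, y_j) = r_j (cos a_j, - sin a_j)] with
    [r_j = sqrt (1 - s_j^2)], [s] uniform on the cube, and with [a_j] uniform on
    the [N] multiples of [2 pi / N] instead of the whole circle: such averages are
    exact on trigonometric polynomials of degree less than [N], and as soon as the
    Riesz nodes are multiples of [2 pi / N] the rotations that matter merely permute
    the angles.  The expectation is thus a finite sum of integrals over the cube.
    *)

(** * Integrals of products for the Lebesgue measure on tuples *)

Section integral_of_product.
Local Open Scope ereal_scope.
Context d1 d2 (T1 : measurableType d1) (T2 : measurableType d2) (R : realType).
Variables (m1 : {sigma_finite_measure set T1 -> \bar R}).
Variables (m2 : {sigma_finite_measure set T2 -> \bar R}).
Variables (f : T1 -> R) (g : T2 -> R).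
Hypothesis intf : m1.-integrable setT (EFin \o f).
Hypothesis intg : m2.-integrable setT (EFin \o g).

Lemma integrable_prodM :
  (m1 \x m2).-integrable setT (fun z => (f z.1 * g z.2)%:E).
Proof.
have mf : measurable_fun setT f.
  by apply/measurable_EFinP; case/integrableP : intf.
have mg : measurable_fun setT g.
  by apply/measurable_EFinP; case/integrableP : intg.
apply/integrable12ltyP.
  apply/measurable_EFinP; apply: measurable_funM.
    exact: measurableT_comp.
  exact: measurableT_comp.
have eqx x : \int[m2]_y `|(f x * g y)%:E| = `|f x|%:E * \int[m2]_y `|(g y)%:E|.
  under eq_integral do rewrite EFinM abseM.
  rewrite ge0_integralZl//.
  by apply/measurable_EFinP; exact: measurableT_comp.
under eq_integral do rewrite /= eqx.
have /integrableP[_ foo] := intf; have /integrableP[_ goo] := intg.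
rewrite ge0_integralZr//.
- apply: lte_mul_pinfty => //; first exact: integral_ge0.
  rewrite ge0_fin_numE//; exact: integral_ge0.
- by apply/measurable_EFinP; exact: measurableT_comp.
- exact: integral_ge0.
Qed.

Lemma integral_prodM : \int[m1 \x m2]_z (f z.1 * g z.2)%:E =
  (\int[m1]_x (f x)%:E) * (\int[m2]_y (g y)%:E).
Proof.
rewrite -integral12_prod_meas1; last exact: integrable_prodM.
rewrite /fubini_F /=.
under eq_integral => x _.
  under eq_integral do rewrite EFinM.
  rewrite integralZl//.
  over.
have gfin : \int[m2]_y (g y)%:E \is a fin_num by exact: integrable_fin_num.
rewrite -(fineK gfin) integralZr//.
Qed.

End integral_of_product.

Section lebesgue_tuple_integral.
Context (R : realType).
Local Open Scope ereal_scope.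

Lemma sigma_finite_lebesgue_tuple n : sigma_finite setT (@lebesgue_tuple R n).
Proof.
pose I (k : nat) : set (measurableTypeR R) := [set` `[- k%:R, k%:R]%R].
have mI k : measurable (I k) by exact: measurable_itv.
exists (fun k => [set x | forall i, I k (tnth x i)]).
  apply/seteqP; split => // x _ /=.
  pose M := (\sum_(i < n) `|tnth x i|)%R.
  exists (Num.truncn M).+1 => //= i; rewrite /I /= in_itv /= -ler_norml.
  apply: (@le_trans _ _ M); last by apply/ltW; exact: truncnS_gt.
  by rewrite /M (bigD1 i)//= lerDl sumr_ge0.
move=> k; split.
  rewrite [X in measurable X](_ : _ =
    \bigcap_(i in [set: 'I_n]) ((fun x => tnth x i) @^-1` I k)).
    apply: fin_bigcap_measurable => // i _.
    by rewrite -[X in measurable X]setTI; exact: measurable_tnth.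
  by apply/seteqP; split => x /= h i; [move=> _|]; exact: h.
rewrite (@lebesgue_tuple_box R n (fun=> I k))//.
suff /andP[] : 0 <= \prod_(i < n) lebesgue_measure (I k) < +oo by [].
elim/big_ind: _ => [|x y /andP[x0 xoo] /andP[y0 yoo]|i _].
- by rewrite lee_fin ler01 ltry.
- by rewrite mule_ge0// lte_mul_pinfty// ge0_fin_numE.
rewrite measure_ge0 lebesgue_measure_itv /=.
by case: ifP => // _; rewrite -EFinB ltry.
Qed.

(** A name of its own for the measure, on which the sigma-finite structure
    required by Fubini's theorem can be attached. *)
Definition lebesgue_tuple_sf n : set (n.-tuple (measurableTypeR R)) -> \bar R :=
  @lebesgue_tuple R n.
HB.instance Definition _ n :=
  Measure.copy (@lebesgue_tuple_sf n) (@lebesgue_tuple R n).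
HB.instance Definition _ n := @Measure_isSigmaFinite.Build _ _ _
  (@lebesgue_tuple_sf n) (@sigma_finite_lebesgue_tuple n).

(** Induction on [n]: the measure on [n.+1]-tuples is the image of a product
    measure under [cons_pair], so Fubini's theorem splits off one coordinate.
    Integrability is part of the induction since Fubini's theorem needs it. *)
Lemma integral_tuple_prod n (g : 'I_n -> R -> R) :
  (forall i, (@lebesgue_measure R).-integrable setT (EFin \o g i)) ->
  (lebesgue_tuple n).-integrable setT
    (fun x : n.-tuple (measurableTypeR R) => (\prod_i g i (tnth x i))%:E) /\
  \int[lebesgue_tuple n]_x (\prod_i g i (tnth x i))%:E =
  \prod_i \int[lebesgue_measure]_t (g i t)%:E.
Proof.
elim: n g => [|n IH] g intg.
  rewrite big_ord0.
  under eq_fun do rewrite big_ord0.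
  split => /=.
    apply/integrableP; split; first exact: measurable_cst.
    by rewrite integral_dirac//= diracT mul1e ltry.
  by rewrite integral_dirac//= diracT mul1e.
have [IH1 IH2] := IH (fun i => g (lift ord0 i)) (fun i => intg _).
pose h (z : n.-tuple (measurableTypeR R) * measurableTypeR R) : \bar R :=
  ((\prod_i g (lift ord0 i) (tnth z.1 i)) * g ord0 z.2)%:E.
pose mul := (@lebesgue_tuple_sf n \x @lebesgue_measure R).
have hE : (fun x : n.+1.-tuple (measurableTypeR R) =>
    (\prod_i g i (tnth x i))%:E) \o (@cons_pair R n) = h.
  apply/funext => -[x y] /=; rewrite /h big_ord_recl /= mulrC.
  by congr (_ * _)%:E; apply: eq_bigr => i _; rewrite tnthS.
have inth : mul.-integrable setT h.
  exact: (@integrable_prodM _ _ _ _ _ (@lebesgue_tuple_sf n) lebesgue_measure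
    (fun x : n.-tuple _ => \prod_i g (lift ord0 i) (tnth x i))%R (g ord0)).
have mh : measurable_fun setT (fun x : n.+1.-tuple (measurableTypeR R) =>
    (\prod_i g i (tnth x i))%:E).
  apply/measurable_EFinP; apply: measurable_prod => i _.
  apply: measurableT_comp; last exact: measurable_tnth.
  by apply/measurable_EFinP; case/integrableP : (intg i).
split.
  apply: (@integrable_pushforward _ _ _ _ _ (@cons_pair R n) _ mul) => //.
    exact: measurable_cons_pair.
  by rewrite preimage_setT hE.
transitivity (\int[mul]_z h z).
  rewrite -hE -(preimage_setT (@cons_pair R n)).
  rewrite -(@integral_pushforward _ _ _ _ _ (@cons_pair R n) _ mul)//.
    exact: measurable_cons_pair.
  by rewrite preimage_setT hE.
rewrite (@integral_prodM _ _ _ _ _ (@lebesgue_tuple_sf n) lebesgue_measure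
  (fun x : n.-tuple _ => \prod_i g (lift ord0 i) (tnth x i))%R (g ord0))//.
by rewrite big_ord_recl muleC IH2.
Qed.
End lebesgue_tuple_integral.

(** * Bounded measurable functions and integrals over the cube *)

Section bounded_measurable.
Context d (T : measurableType d) (R : realType).
Variables (D : set T).

(** Unlike integrable functions these form an algebra, and they are integrable
    over sets of finite measure. *)
Definition bmeas (h : T -> R) :=
  measurable_fun setT h /\ exists C : R, forall x, D x -> `|h x| <= C.

Lemma bmeas_cst c : bmeas (fun=> c).
Proof. by split; [exact: measurable_cst | exists `|c|]. Qed.

Lemma bmeasD f g : bmeas f -> bmeas g -> bmeas (fun x => f x + g x).
Proof.
move=> [mf [C fC]] [mg [B gB]]; split; first exact: measurable_funD.
by exists (C + B) => x Dx; apply: (le_trans (ler_normD _ _)); rewrite lerD ?fC ?gB.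
Qed.

Lemma bmeasM f g : bmeas f -> bmeas g -> bmeas (fun x => f x * g x).
Proof.
move=> [mf [C fC]] [mg [B gB]]; split; first exact: measurable_funM.
by exists (C * B) => x Dx; rewrite normrM ler_pM //; [exact: fC | exact: gB].
Qed.

Lemma bmeasN f : bmeas f -> bmeas (fun x => - f x).
Proof.
move=> [mf [C fC]]; split; first exact: measurableT_comp.
by exists C => x Dx; rewrite normrN fC.
Qed.

Lemma bmeas_sum I (s : seq I) (P : pred I) (h : I -> T -> R) :
  (forall i, bmeas (h i)) -> bmeas (fun x => \sum_(i <- s | P i) h i x).
Proof.
move=> bh; elim: s => [|i s IH].
  by under eq_fun do rewrite big_nil; exact: bmeas_cst.
under eq_fun do rewrite big_cons; case: (P i); [exact: bmeasD|exact: IH].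
Qed.

Lemma bmeas_prod I (s : seq I) (P : pred I) (h : I -> T -> R) :
  (forall i, bmeas (h i)) -> bmeas (fun x => \prod_(i <- s | P i) h i x).
Proof.
move=> bh; elim: s => [|i s IH].
  by under eq_fun do rewrite big_nil; exact: bmeas_cst.
under eq_fun do rewrite big_cons; case: (P i); [exact: bmeasM|exact: IH].
Qed.

Lemma bmeasX f k : bmeas f -> bmeas (fun x => f x ^+ k).
Proof.
move=> bf; elim: k => [|k IH].
  by under eq_fun do rewrite expr0; exact: bmeas_cst.
by under eq_fun do rewrite exprS; exact: bmeasM.
Qed.

Lemma bmeas_meval n (v : 'I_n -> T -> R) (q : mpoly n R) :
  (forall i, bmeas (v i)) -> bmeas (fun x => meval (fun i => v i x) q).
Proof.
move=> bv; under eq_fun do rewrite mevalE.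
apply: bmeas_sum => m; apply: bmeasM; first exact: bmeas_cst.
by apply: bmeas_prod => i; exact: bmeasX.
Qed.

Variable mu : {measure set T -> \bar R}.
Hypotheses (mD : measurable D) (muD : (mu D < +oo)%E).

Lemma bmeas_integrable h : bmeas h -> mu.-integrable D (EFin \o h).
Proof.
move=> [mh [C hC]]; apply: measurable_bounded_integrable => //.
  exact: measurable_funTS.
exists C; split; first exact: num_real.
by move=> x Cx y Dy /=; apply: (le_trans (hC _ Dy)); exact: ltW.
Qed.

Lemma Rintegral_bmeas_sum I (s : seq I) (P : pred I) (h : I -> T -> R) :
  (forall i, bmeas (h i)) ->
  \int[mu]_(x in D) (\sum_(i <- s | P i) h i x) =
  \sum_(i <- s | P i) \int[mu]_(x in D) h i x.
Proof.
move=> bh; elim: s => [|i s IH].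
  rewrite big_nil; under eq_Rintegral do rewrite big_nil.
  by rewrite Rintegral_cst// mul0r.
rewrite big_cons; under eq_Rintegral do rewrite big_cons.
case: (P i) => //; rewrite RintegralD ?IH//; apply: bmeas_integrable => //.
exact: bmeas_sum.
Qed.

End bounded_measurable.

Section interval_integrals.
Context (R : realType).

Definition int1 (g : R -> R) := \int[@lebesgue_measure R]_(t in `[-1, 1]) g t.

Lemma lebesgue_itv11 : (@lebesgue_measure R `[(-1)%R, 1%R] < +oo)%E.
Proof. by rewrite lebesgue_measure_itv /=; case: ifP => // _;
  rewrite -EFinB ltry. Qed.

Lemma bmeas_id : bmeas [set` `[(-1 : R), 1]] (fun t : measurableTypeR R => t).
Proof.
split; first exact: measurable_id.
by exists 1 => x /=; rewrite in_itv /= ler_norml.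
Qed.

(** The only use of the fundamental theorem of calculus: the moments of [t] and
    of [1 - t ^+ 2] come from explicit primitive polynomials. *)
Lemma int1_deriv (p : {poly R}) : int1 (horner p^`()) = p.[1] - p.[-1].
Proof.
rewrite /int1 /Rintegral (@continuous_FTC2 _ _ (horner p))//.
- by apply: continuous_subspaceT; exact: continuous_horner.
- split; first by move=> x _; exact: derivable_horner.
    by apply: cvg_at_right_filter; exact: continuous_horner.
  by apply: cvg_at_left_filter; exact: continuous_horner.
- by move=> x _; rewrite derivE.
Qed.
End interval_integrals.

Section interval_moments.
Context (R : realType).
Local Notation int1 := (@int1 R).

Lemma bmeas_integrable1 g :
  bmeas [set` `[(-1 : R), 1]] (g : measurableTypeR R -> R) ->
  (@lebesgue_measure R).-integrable [set` `[(-1 : R), 1]] (EFin \o g).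
Proof.
move=> bg; apply: bmeas_integrable => //; exact: lebesgue_itv11.
Qed.

Lemma int1Z c g : bmeas [set` `[(-1 : R), 1]] (g : measurableTypeR R -> R) ->
  int1 (fun t => c * g t) = c * int1 g.
Proof.
move=> bg; rewrite /int1 RintegralZl//; exact: bmeas_integrable1.
Qed.

Lemma int1D f g : bmeas [set` `[(-1 : R), 1]] (f : measurableTypeR R -> R) ->
  bmeas [set` `[(-1 : R), 1]] (g : measurableTypeR R -> R) ->
  int1 (fun t => f t + g t) = int1 f + int1 g.
Proof.
move=> bf bg; rewrite /int1 RintegralD//.
exact: bmeas_integrable1.
exact: bmeas_integrable1.
Qed.

Lemma int1_moment a : int1 (fun t => t ^+ a) = (1 + (-1) ^+ a) / a.+1%:R.
Proof.
have -> : (fun t : R => t ^+ a) = horner ((a.+1%:R^-1 *: 'X^(a.+1))^`()).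
  apply/funext => t; rewrite derivZ derivXn /= hornerZ hornerMn hornerXn.
  by rewrite -[X in _ * X]mulr_natl mulrA mulVf ?mul1r// pnatr_eq0.
by rewrite int1_deriv !hornerZ !hornerXn expr1n exprS; field;
  rewrite addrC natr1 pnatr_eq0.
Qed.

Lemma int1_momentSS a :
  a.+3%:R * int1 (fun t => t ^+ a.+2) = a.+1%:R * int1 (fun t => t ^+ a).
Proof.
rewrite !int1_moment !exprS mulN1r mulN1r opprK.
by rewrite !mulrA ![_%:R * _]mulrC !mulfK ?pnatr_eq0.
Qed.

(** The moment of order [2 m] of the distance to the axis of the sphere, whose
    square is [1 - t^2] at height [t]. *)
Definition rad_moment m := int1 (fun t => (1 - t ^+ 2) ^+ m).

Lemma rad_moment0 : rad_moment 0 = 2.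
Proof.
have -> : rad_moment 0 = int1 (fun t => t ^+ 0) by [].
by rewrite int1_moment expr0 divr1.
Qed.

Lemma bmeas_radX m : bmeas [set` `[(-1 : R), 1]]
  (fun t : measurableTypeR R => (1 - t ^+ 2) ^+ m : R).
Proof.
apply: bmeasX; apply: bmeasD; first exact: bmeas_cst.
by apply: bmeasN; apply: bmeasX; exact: bmeas_id.
Qed.

(** [t (1 - t^2)^(m+1)] vanishes at both ends, so its derivative has integral 0. *)
Lemma rad_momentS m :
  (2 * m + 3)%:R * rad_moment m.+1 = (2 * m + 2)%:R * rad_moment m.
Proof.
apply/eqP; rewrite -subr_eq0; apply/eqP.
rewrite /rad_moment -mulNr -!int1Z -?int1D; try exact: bmeas_radX;
  try by apply: bmeasM; [exact: bmeas_cst|exact: bmeas_radX].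
have -> : (fun t : R => (2 * m + 3)%:R * (1 - t ^+ 2) ^+ m.+1 +
    - (2 * m + 2)%:R * (1 - t ^+ 2) ^+ m) =
    horner (('X * (1 - 'X^2) ^+ m.+1 : {poly R})^`()).
  apply/funext => t; rewrite derivM derivX mul1r deriv_exp derivB derivC derivXn /=
    sub0r.
  rewrite !(hornerM, hornerMn, hornerD, hornerN, hornerX, hornerXn, hornerC,
    horner_exp).
  by rewrite exprS expr1; ring.
rewrite int1_deriv !(hornerM, horner_exp, hornerD, hornerN, hornerX, hornerXn,
  hornerC).
by rewrite mulrNN mulr1 subrr exprS mul0r !mulr0 subrr.
Qed.
End interval_moments.

Section cube_integral.
Context (R : realType) (n : nat).
Local Notation T := (n.-tuple (measurableTypeR R)).
Local Notation bm := (@bmeas _ T R (cube R n)).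

Lemma cube_finite : (@lebesgue_tuple R n (cube R n) < +oo)%E.
Proof.
rewrite (@lebesgue_tuple_box R n (fun=> [set` `[(-1 : R), 1]])); last first.
  by move=> i; exact: measurable_itv.
suff /andP[] : (0 <=
  \prod_(i < n) lebesgue_measure [set` `[(-1 : R)%R, 1%R]] < +oo)%E by [].
elim/big_ind: _ => [|x y /andP[x0 xoo] /andP[y0 yoo]|i _].
- by rewrite lee_fin ler01 ltry.
- by rewrite mule_ge0// lte_mul_pinfty// ge0_fin_numE.
by rewrite measure_ge0 lebesgue_itv11.
Qed.

Lemma bmeas_coord i g : bmeas [set` `[(-1 : R), 1]] (g : measurableTypeR R -> R) ->
  bm (fun x => g (tnth x i)).
Proof.
move=> [mg [C gC]]; split; last by exists C => x xc; apply: gC; exact: xc.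
by apply: (measurableT_comp mg); exact: measurable_tnth.
Qed.

Definition cubeint (h : T -> R) := \int[lebesgue_tuple n]_(x in cube R n) h x.

Lemma cube_integrable h : bm h ->
  (lebesgue_tuple n).-integrable (cube R n) (EFin \o h).
Proof. by apply: bmeas_integrable; [exact: measurable_cube|exact: cube_finite]. Qed.

Lemma cubeint_EFin h : bm h ->
  (\int[lebesgue_tuple n]_(x in cube R n) (h x)%:E)%E = (cubeint h)%:E.
Proof.
move=> bh; rewrite /cubeint /Rintegral fineK//.
apply: integrable_fin_num; first exact: measurable_cube.
exact: cube_integrable.
Qed.

Lemma cubeintD f g : bm f -> bm g -> cubeint (fun x => f x + g x) =
  cubeint f + cubeint g.
Proof.
by move=> bf bg; apply: RintegralD; [exact: measurable_cube|exact: cube_integrable..].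
Qed.

Lemma cubeintZ c f : bm f -> cubeint (fun x => c * f x) = c * cubeint f.
Proof.
by move=> bf; apply: RintegralZl; [exact: measurable_cube|exact: cube_integrable].
Qed.

Lemma le_cubeint f g : bm f -> bm g -> (forall x, cube R n x -> f x <= g x) ->
  cubeint f <= cubeint g.
Proof.
by move=> bf bg; apply: le_Rintegral;
  [exact: measurable_cube|exact: cube_integrable..].
Qed.

Lemma eq_cubeint f g : (forall x, cube R n x -> f x = g x) -> cubeint f = cubeint g.
Proof. by move=> fg; apply: eq_Rintegral => x /set_mem; exact: fg. Qed.

Lemma cubeint_sum I (s : seq I) (P : pred I) (h : I -> T -> R) :
  (forall i, bm (h i)) ->
  cubeint (fun x => \sum_(i <- s | P i) h i x) = \sum_(i <- s | P i) cubeint (h i).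
Proof.
by apply: Rintegral_bmeas_sum; [exact: measurable_cube|exact: cube_finite].
Qed.

Lemma cubeint_prod (g : 'I_n -> R -> R) :
  (forall i, bmeas [set` `[(-1 : R), 1]] (g i : measurableTypeR R -> R)) ->
  cubeint (fun x => \prod_i g i (tnth x i)) = \prod_i int1 (g i).
Proof.
move=> bg; pose J := [set` `[(-1 : R), 1]].
pose g' i : R -> R := (g i) \_ J.
have ig' i : (@lebesgue_measure R).-integrable setT (EFin \o g' i).
  rewrite /g' -restrict_EFin; apply/(integrable_mkcond _ _).1 => //.
    exact: measurable_itv.
  exact: bmeas_integrable1.
have [_ e] := integral_tuple_prod ig'.
apply: EFin_inj; rewrite -cubeint_EFin; last first.
  by apply: bmeas_prod => i; exact: bmeas_coord.
have -> : (\prod_i int1 (g i))%:E = (\prod_i \int[lebesgue_measure]_t (g' i t)%:E)%E.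
  rewrite -prodEFin; apply: eq_bigr => i _.
  rewrite /int1 /Rintegral fineK; last by apply: integrable_fin_num => //;
    exact: bmeas_integrable1.
  by rewrite integral_mkcond restrict_EFin.
rewrite -e integral_mkcond; apply: eq_integral => x _.
rewrite patchE; case: ifPn => [/set_mem xc|/negP xc].
  congr EFin; apply: eq_bigr => i _; rewrite /g' patchE mem_set//; exact: xc.
have [i xi] : exists i, ~ J (tnth x i).
  by apply/existsNP => xJ; apply: xc; apply/mem_set => i; exact: xJ.
by rewrite (bigD1 i)//= /g' patchE memNset// mul0r.
Qed.

End cube_integral.

(** * Trigonometric polynomials and the interpolation formula of M. Riesz *)

Section trigonometric_sums.
Context (R : realType).
Implicit Types (a b x t : R).

Lemma sin_sub_mul a b : sin (a + b) - sin (a - b) = 2 * sin b * cos a.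
Proof. by rewrite sinD sinB; ring. Qed.

Lemma sum_cos_arith N a b :
  2 * sin b * \sum_(l < N) cos (a + l%:R * (2 * b)) =
  sin (a + N%:R * (2 * b) - b) - sin (a - b).
Proof.
elim: N => [|N IH]; first by rewrite big_ord0 mulr0 mul0r addr0 subrr.
rewrite big_ord_recr /= mulrDr IH -sin_sub_mul.
have -> : a + N.+1%:R * (2 * b) - b = a + N%:R * (2 * b) + b by rewrite -natr1; ring.
by rewrite addrC addrA subrK.
Qed.

Lemma sinDpin x j : sin (x + j%:R * (2 * pi)) = sin x.
Proof. by rewrite mulr_natl [2 * pi]mulr_natl periodicn//; exact: sinD2pi. Qed.

Lemma cosDpin x j : cos (x + j%:R * (2 * pi)) = cos x.
Proof. by rewrite mulr_natl [2 * pi]mulr_natl periodicn//; exact: cosD2pi. Qed.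

(** The sum telescopes after multiplication by the sine of half the step, and
    the [N] steps make [j] full turns. *)
Lemma sum_cos_eq0 N j a : (0 < j < N)%N ->
  \sum_(l < N) cos (a + l%:R * (2 * (j%:R * pi / N%:R))) = 0.
Proof.
move=> /andP[j0 jN]; set b := j%:R * pi / N%:R.
have N0 : N%:R != 0 :> R by rewrite pnatr_eq0 -lt0n; exact: ltn_trans jN.
have sb : 0 < sin b.
  apply: sin_gt0_pi; apply/andP; split;
    first by rewrite divr_gt0 ?mulr_gt0 ?ltr0n ?pi_gt0 ?(ltn_trans j0 jN).
  by rewrite ltr_pdivrMr ?ltr0n ?(ltn_trans j0 jN)// mulrC ltr_pM2l ?pi_gt0// ltr_nat.
have := sum_cos_arith N a b.
have -> : a + N%:R * (2 * b) - b = a - b + j%:R * (2 * pi).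
  by rewrite /b; field.
rewrite sinDpin subrr => /eqP; rewrite mulf_eq0 => /orP[|/eqP//].
by rewrite mulf_eq0 pnatr_eq0 /= (gt_eqF sb).
Qed.

(** Trigonometric polynomials of degree at most [d] paired with their
    derivatives.  Carrying the derivative along makes linear identities between
    values of [T] and of [T'] provable on the generators [cos (b + m t)] only, and
    replaces differentiation by the product rule of [trig_pair_mul_cos]. *)
Inductive trig_pair (d : nat) : (R -> R) -> (R -> R) -> Prop :=
| trig_pair_cos b m : (m <= d)%N ->
    trig_pair d (fun t => cos (b + m%:R * t)) (fun t => - (m%:R * sin (b + m%:R * t)))
| trig_pairD S S' T T' : trig_pair d S S' -> trig_pair d T T' ->
    trig_pair d (fun t => S t + T t) (fun t => S' t + T' t)
| trig_pairZ c T T' : trig_pair d T T' ->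
    trig_pair d (fun t => c * T t) (fun t => c * T' t).

Lemma trig_pair_ext d S S' T T' :
  trig_pair d S S' -> S =1 T -> S' =1 T' -> trig_pair d T T'.
Proof. by move=> tS /funext <- /funext <-. Qed.

Lemma trig_pair_mono d e T T' : (d <= e)%N -> trig_pair d T T' -> trig_pair e T T'.
Proof.
move=> de; elim=> [b m md|S S' U U' _ IHS _ IHU|c S S' _ IH].
- by apply: trig_pair_cos; exact: leq_trans de.
- exact: trig_pairD.
- exact: trig_pairZ.
Qed.

Lemma trig_pair0 d : trig_pair d (fun=> 0) (fun=> 0).
Proof.
have t0 := trig_pairZ 0 (@trig_pair_cos d 0 0 (leq0n _)).
by apply: (trig_pair_ext t0) => t; rewrite mul0r.
Qed.

Lemma trig_pair1 d : trig_pair d (fun=> 1) (fun=> 0).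
Proof.
have t0 := @trig_pair_cos d 0 0 (leq0n _).
by apply: (trig_pair_ext t0) => t; rewrite mul0r ?add0r ?cos0 ?oppr0.
Qed.

(** The product-to-sum formula.  For [m = 0] the frequency [m - 1] is negative and
    the second cosine is the generator of frequency 1 with opposite phase. *)
Lemma trig_pair_mul_cos d T T' a : trig_pair d T T' ->
  trig_pair d.+1 (fun t => T t * cos (a + t))
    (fun t => T' t * cos (a + t) - T t * sin (a + t)).
Proof.
elim=> {T T'} [b m md|S S' U U' _ IHS _ IHU|c S S' _ IH].
- have tp : trig_pair d.+1 _ _ := @trig_pair_cos d.+1 (b + a) m.+1 md.
  have tm : trig_pair d.+1 (fun t => cos (b - a + (m%:R - 1) * t))
      (fun t => - ((m%:R - 1) * sin (b - a + (m%:R - 1) * t))).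
    case: m md {tp} => [|m] md.
      apply: (trig_pair_ext (@trig_pair_cos d.+1 (a - b) 1 isT)) => t.
        by rewrite -cosN; congr cos; ring.
      have -> : a - b + 1%:R * t = - (b - a + (0%:R - 1) * t) by ring.
      by rewrite sinN; ring.
    have tm := @trig_pair_cos d.+1 (b - a) m (leqW (ltnW md)).
    by apply: (trig_pair_ext tm) => t; rewrite -natr1 addrK.
  apply: (trig_pair_ext (trig_pairZ (2^-1) (trig_pairD tp tm))) => t /=.
    have -> : b + a + m.+1%:R * t = (b + m%:R * t) + (a + t) by rewrite -natr1; ring.
    have -> : b - a + (m%:R - 1) * t = (b + m%:R * t) - (a + t) by ring.
    by rewrite cosD cosB; field.
  have -> : b + a + m.+1%:R * t = (b + m%:R * t) + (a + t) by rewrite -natr1; ring.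
  have -> : b - a + (m%:R - 1) * t = (b + m%:R * t) - (a + t) by ring.
  by rewrite sinD sinB -natr1; field.
- by apply: (trig_pair_ext (trig_pairD IHS IHU)) => t; ring.
- by apply: (trig_pair_ext (trig_pairZ c IH)) => t; ring.
Qed.

(** Sums over [N] equally spaced points are exact below degree [N], and a
    derivative has mean value 0. *)
Lemma mean_deriv_eq0 d N T T' : (d < N)%N -> trig_pair d T T' ->
  \sum_(l < N) T' (l%:R * (2 * pi / N%:R)) = 0.
Proof.
move=> dN; elim=> {T T'} [b m md|S S' U U' _ IHS _ IHU|c S S' _ IH].
- rewrite sumrN -mulr_sumr; case: m md => [|m] md; first by rewrite mul0r oppr0.
  have : (0 < m.+1 < N)%N by rewrite /= (leq_ltn_trans md).
  move=> /(sum_cos_eq0 (b - pi / 2)) e.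
  rewrite (eq_bigr (fun l : 'I_N =>
    cos (b - pi / 2 + l%:R * (2 * (m.+1%:R * pi / N%:R))))).
    by rewrite e mulr0 oppr0.
  by move=> l _; rewrite -cosBpihalf; congr cos; ring.
- by rewrite big_split /= IHS IHU addr0.
- by rewrite -mulr_sumr IH mulr0.
Qed.

End trigonometric_sums.

Section riesz_interpolation.
Context (R : realType) (d : nat).
Hypothesis d_gt0 : (0 < d)%N.

Let d0 : d%:R != 0 :> R. Proof. by rewrite pnatr_eq0 -lt0n. Qed.

(** The zeros of [cos (d t)] in one period. *)
Definition riesz_node l : R := l.*2.+1%:R * (pi / d.*2%:R).
Definition riesz_weight l : R := (-1) ^+ l / (4 * d%:R * sin (riesz_node l / 2) ^+ 2).

Lemma riesz_nodeE l : riesz_node l = (2 * l%:R + 1) * (pi / (2 * d%:R)).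
Proof. by rewrite /riesz_node -natr1 -!mul2n !natrM. Qed.

Lemma sin_riesz_node_gt0 (l : 'I_d.*2) : 0 < sin (riesz_node l / 2).
Proof.
have dd : 0 < d.*2%:R :> R by rewrite ltr0n double_gt0.
apply: sin_gt0_pi; rewrite /riesz_node; apply/andP; split.
  by rewrite divr_gt0// mulr_gt0 ?divr_gt0 ?pi_gt0.
rewrite ltr_pdivrMr ?ltr0n// mulrA ltr_pdivrMr// -mulrA mulrC ltr_pM2l ?pi_gt0//.
rewrite -natrM ltr_nat; have := ltn_ord l; lia.
Qed.

Lemma norm_riesz_weight (l : 'I_d.*2) :
  `|riesz_weight l| = (4 * d%:R * sin (riesz_node l / 2) ^+ 2)^-1.
Proof.
rewrite normrM normrX normrN1 expr1n mul1r ger0_norm// invr_ge0.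
by rewrite mulr_ge0 ?sqr_ge0// mulr_ge0.
Qed.

Lemma cos_dnode l : cos (d%:R * riesz_node l) = 0.
Proof.
have -> : d%:R * riesz_node l = l%:R * pi + pi / 2.
  by rewrite riesz_nodeE; field.
elim: l => [|l IH]; first by rewrite mul0r add0r cos_pihalf.
by rewrite -natr1 mulrDl mul1r addrAC cosDpi IH oppr0.
Qed.

Lemma sin_dnode l : sin (d%:R * riesz_node l) = (-1) ^+ l.
Proof.
have -> : d%:R * riesz_node l = l%:R * pi + pi / 2.
  by rewrite riesz_nodeE; field.
elim: l => [|l IH]; first by rewrite mul0r add0r sin_pihalf expr0.
by rewrite -natr1 mulrDl mul1r addrAC sinDpi IH exprS mulN1r.
Qed.

Lemma sum_cos_node j : (0 < j < d.*2)%N ->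
  \sum_(l < d.*2) cos (j%:R * riesz_node l) = 0.
Proof.
move=> jd; rewrite -[RHS](sum_cos_eq0 (j%:R * pi / d.*2%:R) jd).
by apply: eq_bigr => l _; congr cos; rewrite /riesz_node -addn1 natrD -mul2n natrM;
  ring.
Qed.

(** The nodes [t] and [2 pi - t] carry opposite weights. *)
Lemma riesz_cos m : \sum_(l < d.*2) riesz_weight l * cos (m%:R * riesz_node l) = 0.
Proof.
set S := (X in X = _); suff : S = - S by lra.
rewrite {1}/S (reindex_inj rev_ord_inj) /= /S -sumrN; apply: eq_bigr => l _.
have nodeE : riesz_node (d.*2 - l.+1) = 2 * pi - riesz_node l.
  have ld : (d.*2 - l.+1).*2.+1 = (d.*2.*2 - l.*2.+1)%N by have := ltn_ord l; lia.
  rewrite /riesz_node ld natrB; last by have := ltn_ord l; lia.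
  by rewrite mulrBl; congr (_ - _); rewrite -!mul2n !natrM; field.
rewrite nodeE.
have -> : m%:R * (2 * pi - riesz_node l) = - (m%:R * riesz_node l) + m%:R * (2 * pi).
  by ring.
rewrite cosDpin cosN -mulNr; congr (_ * _); rewrite /riesz_weight nodeE.
rewrite -[in RHS]mulNr; congr (_ / (_ * _ ^+ 2)).
  rewrite -[LHS]signr_odd -[(-1) ^+ l]signr_odd oddB; last by have := ltn_ord l; lia.
  by rewrite odd_double /=; case: (odd l); rewrite ?opprK.
have -> : (2 * pi - riesz_node l) / 2 = - (riesz_node l / 2) + pi by field.
by rewrite sinDpi sinN opprK.
Qed.

Let b_ m := \sum_(l < d.*2) riesz_weight l * sin (m%:R * riesz_node l).

(** Taking second differences in [m] multiplies [sin (m t)] by [- 4 sin^2 (t/2)],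
    which cancels the denominators of the weights; what remains vanishes by
    orthogonality for [m.+1 < d], so [b_ m] is linear in [m].  The slope is then
    read off at [m.+1 = d], where [b_ d.+1 = b_ d.-1] because [cos (d t)] vanishes
    at the nodes. *)
Let b_diff2 m : b_ m.+2 + b_ m - 2 * b_ m.+1 =
  - d%:R^-1 *
  \sum_(l < d.*2) sin (d%:R * riesz_node l) * sin (m.+1%:R * riesz_node l).
Proof.
rewrite /b_ !mulr_sumr -big_split -sumrB /=; apply: eq_bigr => l _.
rewrite sin_dnode /riesz_weight; set t := riesz_node l.
have s0 : sin (t / 2) != 0 by rewrite gt_eqF// sin_riesz_node_gt0.
have -> : sin (m.+2%:R * t) = sin (m.+1%:R * t + (t / 2) *+ 2).
  by congr sin; rewrite -natr1; field.
have -> : sin (m%:R * t) = sin (m.+1%:R * t - (t / 2) *+ 2).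
  by congr sin; rewrite -natr1; field.
rewrite sinD sinB cos_mulr2n cos2sin2; field.
by rewrite s0 d0.
Qed.

Let b_ortho j : (0 < j < d)%N ->
  \sum_(l < d.*2) sin (d%:R * riesz_node l) * sin (j%:R * riesz_node l) = 0.
Proof.
move=> /andP[j0 jd].
transitivity (2^-1 * (\sum_(l < d.*2) cos ((d - j)%:R * riesz_node l) -
    \sum_(l < d.*2) cos ((d + j)%:R * riesz_node l))).
  rewrite -sumrB mulr_sumr; apply: eq_bigr => l _.
  by rewrite natrB ?(ltnW jd)// natrD mulrBl mulrDl cosB cosD; field.
by rewrite !sum_cos_node ?subrr ?mulr0//; lia.
Qed.

Let b_lin m : (m < d)%N -> b_ m.+1 = m.+1%:R * b_ 1 /\ b_ m = m%:R * b_ 1.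
Proof.
have b0 : b_ 0 = 0.
  by rewrite /b_ big1// => l _; rewrite mul0r sin0 mulr0.
elim: m => [|m IH] md; first by rewrite mul1r b0 mul0r.
have [e1 e0] := IH (ltnW md).
have := b_diff2 m; rewrite b_ortho// mulr0 e0 e1 => e; split => //.
by move: e; rewrite -!natr1; lra.
Qed.

Let b1 : b_ 1 = 1.
Proof.
have := b_diff2 d.-1; rewrite prednK//.
have -> : b_ d.+1 = b_ d.-1.
  apply: eq_bigr => l _; congr (_ * _).
  rewrite -natr1 -[in RHS]subn1 natrB// mulrDl mulrBl mul1r sinD sinB.
  by rewrite cos_dnode !mul0r subr0 addr0.
have [-> ->] : b_ d = d%:R * b_ 1 /\ b_ d.-1 = d.-1%:R * b_ 1.
  by have := @b_lin d.-1; rewrite prednK //; apply.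
rewrite (eq_bigr (fun=> 1)); last first.
  by move=> l _; rewrite sin_dnode -expr2 sqrr_sign.
rewrite sumr_const card_ord -mul2n -[d.-1]subn1 natrB// => e.
have : - d%:R^-1 * (1 *+ (2 * d)) = - 2 :> R by rewrite natrM; field.
lra.
Qed.

Lemma riesz_sin m : (m <= d)%N ->
  \sum_(l < d.*2) riesz_weight l * sin (m%:R * riesz_node l) = m%:R.
Proof.
case: m => [|m] md; first by rewrite big1// => l _; rewrite mul0r sin0 mulr0.
by have [e _] := b_lin md; rewrite -/(b_ m.+1) e b1 mulr1.
Qed.

(** On [cos (b + m t)] this is the addition formula together with [riesz_cos] and
    [riesz_sin]. *)
Lemma riesz_interpolation T T' t : trig_pair d T T' ->
  \sum_(l < d.*2) riesz_weight l * T (t + riesz_node l) = T' t.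
Proof.
elim=> {T T'} [b m md|S S' U U' _ IHS _ IHU|c S S' _ IH].
- transitivity (cos (b + m%:R * t) *
      (\sum_(l < d.*2) riesz_weight l * cos (m%:R * riesz_node l)) -
    sin (b + m%:R * t) *
      \sum_(l < d.*2) riesz_weight l * sin (m%:R * riesz_node l)).
    rewrite !mulr_sumr -sumrB; apply: eq_bigr => l _.
    by rewrite mulrDr addrA [cos (_ + _ + _ * riesz_node _)]cosD; ring.
  by rewrite riesz_cos riesz_sin// mulr0 sub0r mulrC.
- by rewrite -IHS -IHU -big_split /=; apply: eq_bigr => l _; rewrite mulrDr.
- by rewrite -IH mulr_sumr; apply: eq_bigr => l _; rewrite mulrCA.
Qed.

(** [(-1)^l = sin (d t_l)], so this is the case [m = d] of [riesz_sin]. *)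
Lemma sum_norm_riesz_weight : \sum_(l < d.*2) `|riesz_weight l| = d%:R.
Proof.
rewrite -[RHS](riesz_sin (leqnn d)); apply: eq_bigr => l _.
by rewrite norm_riesz_weight sin_dnode /riesz_weight [RHS]mulrAC -expr2 sqrr_sign
  mul1r.
Qed.

End riesz_interpolation.

(** * Rotation of a polynomial, and moments of one spherical coordinate *)

Section trig_meval.
Context (R : realType) (n : nat).

(** First coordinate, and its derivative, of points turning at unit speed on
    circles of radii [r i] from the phases [a i]. *)
Definition orbit_pt (r a : 'I_n -> R) (t : R) (i : 'I_n) := r i * cos (a i + t).
Definition orbit_vel (r a : 'I_n -> R) (t : R) (i : 'I_n) := - (r i * sin (a i + t)).

Lemma trig_pair_monomial r a (m : multinom n) :
  trig_pair (mdeg m) (fun t => meval (orbit_pt r a t) (mpolyX R m))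
    (fun t => \sum_j orbit_vel r a t j *
      meval (orbit_pt r a t) (mderiv j (mpolyX R m))).
Proof.
move: {2}(mdeg m) (erefl (mdeg m)) => e; elim: e m => [|e IH] m me.
  have -> : m = mnm0 by apply/eqP; rewrite -mdeg_eq0 me.
  apply: (trig_pair_ext (@trig_pair1 R _)) => t; first by rewrite mpolyX0 meval1.
  by rewrite big1// => j _; rewrite mpolyX0 mderivC meval0 mulr0.
have [i mi] : exists i, (0 < m i)%N.
  apply/existsP; apply: contraTT isT; rewrite negb_exists => /forallP m0.
  move: me; rewrite mdegE big1// => i _; apply/eqP; rewrite -leqn0 leqNgt; exact: m0.
pose m' := mnm_sub m (mnm1 i).
have mE : m = mnm_add m' (mnm1 i).
  by rewrite submK//; apply/mnm_lepP => j; rewrite mnm1E; case: eqP => [<-|].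
have m'e : mdeg m' = e by move: me; rewrite mE mdegD mdeg1 addn1 => -[].
have := trig_pairZ (r i) (trig_pair_mul_cos (a i) (IH _ m'e)).
rewrite m'e me => tp; apply: (trig_pair_ext tp) => t.
  by rewrite [in RHS]mE mpolyXD mevalM mevalXU /orbit_pt; ring.
rewrite [RHS](eq_bigr (fun j => r i * cos (a i + t) *
    (orbit_vel r a t j * meval (orbit_pt r a t) (mderiv j (mpolyX R m'))) +
    meval (orbit_pt r a t) (mpolyX R m') *
      (orbit_vel r a t j * (i == j)%:R))).
  rewrite big_split /= -!mulr_sumr [X in _ = _ + _ * X](bigD1 i)//= eqxx.
  rewrite [X in _ = _ + _ * (_ + X)]big1 => [|j ji]; last first.
    by rewrite eq_sym (negPf ji) mulr0.
  by rewrite mulr1 addr0 /orbit_vel; ring.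
move=> j _; rewrite mE mpolyXD mderivM mevalD !mevalM mevalXU.
rewrite [mderiv j (mpolyX R (mnm1 i))]mderivX mevalZ mnm1E.
case: (eqVneq i j) => [<-|_] /=; last by rewrite /orbit_pt; ring.
have -> : mnm_sub (mnm1 i) (mnm1 i) = mnm0 :> multinom n.
  by apply/mnmP => k; rewrite mnmBE subnn mnm0E.
by rewrite mpolyX0 meval1 /orbit_pt; ring.
Qed.

(** The derivative is the chain rule, and the degree in [t] is at most the total
    degree because all the coordinates turn at the same speed. *)
Lemma trig_pair_meval r a d (f : mpoly n R) : (mmeasure mdeg f <= d.+1)%N ->
  trig_pair d (fun t => meval (orbit_pt r a t) f)
    (fun t => \sum_j orbit_vel r a t j * meval (orbit_pt r a t) (mderiv j f)).
Proof.
move=> fd; pose P (g : mpoly n R) :=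
  trig_pair d (fun t => meval (orbit_pt r a t) g)
    (fun t => \sum_j orbit_vel r a t j * meval (orbit_pt r a t) (mderiv j g)).
rewrite -/(P f) [f]mpolyE big_seq; elim/big_ind: _.
- apply: (trig_pair_ext (@trig_pair0 R d)) => t; first by rewrite meval0.
  by rewrite big1// => j _; rewrite mderiv0 meval0 mulr0.
- move=> g h Pg Ph; apply: (trig_pair_ext (trig_pairD Pg Ph)) => t;
    first by rewrite mevalD.
  by rewrite -big_split /=; apply: eq_bigr => j _; rewrite mderivD mevalD mulrDr.
move=> m mf.
have md : (mdeg m <= d)%N by rewrite -ltnS (leq_trans (msize_mdeg_lt mf)).
have := trig_pairZ (mcoeff m f) (trig_pair_mono md (trig_pair_monomial r a m)).
move=> tp; apply: (trig_pair_ext tp) => t; first by rewrite mevalZ.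
by rewrite mulr_sumr; apply: eq_bigr => j _; rewrite mderivZ mevalZ mulrCA.
Qed.
End trig_meval.

Section cos_moments.
Context (R : realType) (N' : nat).
Let N := N'.+1.
Let N0 : N%:R != 0 :> R. Proof. by rewrite pnatr_eq0. Qed.

Definition angle (l : nat) : R := l%:R * (2 * pi / N%:R).
Definition avg (g : 'I_N -> R) := N%:R^-1 * \sum_l g l.

Lemma trig_pair_mul_cosX d (T T' : R -> R) (tp : trig_pair d T T') a :
  trig_pair (d + a) (fun t => T t * cos t ^+ a)
    (fun t => T' t * cos t ^+ a - T t * (a%:R * cos t ^+ a.-1 * sin t)).
Proof.
elim: a => [|a IH].
  by rewrite addn0; apply: (trig_pair_ext tp) => t; rewrite expr0; ring.
rewrite addnS; apply: (trig_pair_ext (trig_pair_mul_cos 0 IH)) => t.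
  by rewrite add0r exprSr mulrA.
rewrite add0r exprSr -natr1; case: a {IH} => [|a] /=; first by rewrite expr0; ring.
by rewrite exprSr; ring.
Qed.

Lemma avg_cosX_sin a : (a.+1 < N)%N ->
  avg (fun l => cos (angle l) ^+ a * sin (angle l)) = 0.
Proof.
move=> aN; have tp := trig_pair_mul_cosX (trig_pair1 R 0) a.+1.
have := mean_deriv_eq0 aN tp; rewrite (eq_bigr (fun l : 'I_N =>
  - a.+1%:R * (cos (angle l) ^+ a * sin (angle l)))); last first.
  by move=> l _; rewrite /angle /=; ring.
rewrite -mulr_sumr => /eqP; rewrite mulf_eq0 oppr_eq0 pnatr_eq0 /= => /eqP e.
by rewrite /avg e mulr0.
Qed.

(** The average of the derivative of [sin t * cos t ^+ a.+1] vanishes: the discrete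
    counterpart of the integration by parts that computes Wallis' integrals. *)
Lemma avg_cosSS a : (a.+2 < N)%N ->
  a.+2%:R * avg (fun l => cos (angle l) ^+ a.+2) =
  a.+1%:R * avg (fun l => cos (angle l) ^+ a).
Proof.
move=> aN.
have ts : trig_pair 1 (@sin R) (@cos R).
  apply: (trig_pair_ext (@trig_pair_cos R 1 (- (pi / 2)) 1 isT)) => t.
    by rewrite mul1r addrC cosBpihalf.
  by rewrite !mul1r addrC sinBpihalf opprK.
have tp := trig_pair_mul_cosX ts a.+1.
have := mean_deriv_eq0 aN tp; rewrite (eq_bigr (fun l : 'I_N =>
  a.+2%:R * cos (angle l) ^+ a.+2 - a.+1%:R * cos (angle l) ^+ a)); last first.
  move=> l _; rewrite -/(angle l) /=; set x := angle l.
  have -> : sin x * (a.+1%:R * cos x ^+ a * sin x) =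
    a.+1%:R * cos x ^+ a * sin x ^+ 2 by ring.
  by rewrite sin2cos2 !exprS -!natr1; ring.
rewrite sumrB -!mulr_sumr => /eqP; rewrite subr_eq0 => /eqP e.
by rewrite /avg mulrCA e mulrCA.
Qed.

Lemma avg_cos0 : avg (fun l => cos (angle l) ^+ 0) = 1.
Proof. by rewrite /avg sumr_const card_ord mulVf. Qed.

Lemma avg_cos1 : (1 < N)%N -> avg (fun l => cos (angle l) ^+ 1) = 0.
Proof.
move=> N1; rewrite /avg;
have -> : \sum_(l < N) cos (angle l) ^+ 1 = 0; last by rewrite mulr0.
rewrite -[RHS](@sum_cos_eq0 R N 1 0)//; apply: eq_bigr => l _.
by rewrite expr1 /angle; congr cos; ring.
Qed.

Definition disc_rad (s : R) := Num.sqrt (1 - s ^+ 2).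

Lemma bmeas_rad : bmeas [set` `[(-1 : R), 1]] (disc_rad : measurableTypeR R -> R).
Proof.
split.
  apply: (@measurableT_comp _ _ _ _ _ _ (@Num.sqrt R) _
    (fun t : measurableTypeR R => 1 - t ^+ 2)).
    by apply: continuous_measurable_fun; exact: sqrt_continuous.
  apply: measurable_funB; first exact: measurable_cst.
  by apply: measurable_funX; exact: measurable_id.
exists 1 => x _; rewrite /disc_rad ger0_norm ?sqrtr_ge0// -[leRHS]sqrtr1 ler_wsqrtr//.
by rewrite gerBl sqr_ge0.
Qed.

Lemma rad_sqr s : s \in `[-1, 1] -> disc_rad s ^+ 2 = 1 - s ^+ 2.
Proof.
rewrite in_itv /= => s1; rewrite sqr_sqrtr// subr_ge0 -real_normK ?num_real//.
by rewrite expr_le1 ?ler_norml.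
Qed.

Lemma int1_rad_even m : int1 (fun s => disc_rad s ^+ m.*2) = rad_moment R m.
Proof.
apply: eq_Rintegral => s /set_mem s1.
by rewrite -mul2n exprM rad_sqr.
Qed.

(** Archimedes' theorem on moments: a coordinate orthogonal to the axis,
    [sqrt (1 - s^2) * cos a], has the same moments as the height [s].  The two
    recurrences [avg_cosSS] and [rad_momentS] multiply to that of the right-hand
    side. *)
Lemma avg_moment a : (a < N)%N ->
  avg (fun l => cos (angle l) ^+ a) * int1 (fun s => disc_rad s ^+ a) =
  int1 (fun s : R => s ^+ a).
Proof.
rewrite int1_moment -[a]odd_double_half; case: (odd a); move: a./2 => m;
  rewrite ?add1n ?add0n.
  move=> aN; have -> : avg (fun l => cos (angle l) ^+ m.*2.+1) = 0.
    elim: m aN => [|m IH] aN; first exact: avg_cos1.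
    have := avg_cosSS aN; rewrite doubleS IH ?mulr0 => [/eqP|]; last by lia.
    by rewrite mulf_eq0 pnatr_eq0 /= => /eqP.
  by rewrite mul0r exprS -signr_odd odd_double expr0 mulr1 subrr mul0r.
move=> aN; rewrite -signr_odd odd_double expr0 int1_rad_even.
apply: (@mulfI _ m.*2.+1%:R); first by rewrite pnatr_eq0.
rewrite [RHS]mulrC divfK ?pnatr_eq0//.
elim: m aN => [|m IH] aN; first by rewrite avg_cos0 rad_moment0 !mul1r.
have e1 := avg_cosSS aN; have e2 := rad_momentS R m.
rewrite -IH; last by lia.
apply: (@mulfI _ m.*2.+2%:R); first by rewrite pnatr_eq0.
have E2 : (2 * m + 2 = m.*2.+2)%N by lia.
have E3 : (2 * m + 3 = m.*2.+3)%N by lia.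
rewrite E2 E3 in e2; rewrite doubleS.
rewrite [LHS](_ : _ = (m.*2.+2%:R * avg (fun l => cos (angle l) ^+ m.*2.+2)) *
  (m.*2.+3%:R * rad_moment R m.+1)); first by rewrite e1 e2; ring.
by ring.
Qed.

End cos_moments.

(** * Expectation over products of spheres *)

Section sphere_expectation.
Context (R : realType) (n N' : nat).
Local Notation N := (N'.+1).
Local Notation T := (n.-tuple (measurableTypeR R)).
Local Notation Phi := {ffun 'I_n -> 'I_N}.
Local Notation bm := (@bmeas _ T R (cube R n)).
Local Notation angle := (@angle R N').
Local Notation J := [set` `[(-1 : R), 1]].

(** The heights [s] carry the Lebesgue measure of the cube, not normalized: the
    total mass is [2 ^+ n], as for the integrals that [expect] is compared with. *)
Definition expect (h : T -> Phi -> R) : R :=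
  (N%:R ^+ n)^-1 * \sum_phi cubeint (fun s => h s phi).

Definition bmE (h : T -> Phi -> R) := forall phi, bm (fun s => h s phi).

Lemma expectD f g : bmE f -> bmE g ->
  expect (fun s phi => f s phi + g s phi) = expect f + expect g.
Proof.
move=> bf bg; rewrite /expect -mulrDr -big_split /=; congr (_ * _).
by apply: eq_bigr => phi _; rewrite cubeintD.
Qed.

Lemma expectZ c f : bmE f -> expect (fun s phi => c * f s phi) = c * expect f.
Proof.
move=> bf; rewrite /expect mulrCA [c * _]mulr_sumr; congr (_ * _).
by apply: eq_bigr => phi _; rewrite cubeintZ.
Qed.

Lemma expect_sum I (r : seq I) (P : pred I) (h : I -> T -> Phi -> R) :
  (forall i, bmE (h i)) ->
  expect (fun s phi => \sum_(i <- r | P i) h i s phi) =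
    \sum_(i <- r | P i) expect (h i).
Proof.
move=> bh; rewrite /expect -mulr_sumr exchange_big /=; congr (_ * _).
apply: eq_bigr => phi _; rewrite cubeint_sum// => i; exact: bh.
Qed.

Lemma le_expect f g : bmE f -> bmE g ->
  (forall s phi, cube R n s -> f s phi <= g s phi) -> expect f <= expect g.
Proof.
move=> bf bg fg; rewrite /expect ler_wpM2l ?invr_ge0 ?exprn_ge0//.
by apply: ler_sum => phi _; apply: le_cubeint => // s; exact: fg.
Qed.

Lemma eq_expect f g : (forall s phi, cube R n s -> f s phi = g s phi) ->
  expect f = expect g.
Proof.
move=> fg; rewrite /expect; congr (_ * _); apply: eq_bigr => phi _.
by apply: eq_cubeint => s; exact: fg.
Qed.

Lemma expect_prod (g : 'I_n -> R -> 'I_N -> R) :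
  (forall i l, bmeas J ((fun s => g i s l) : measurableTypeR R -> R)) ->
  expect (fun s phi => \prod_i g i (tnth s i) (phi i)) =
  \prod_i avg (fun l => int1 (fun s => g i s l)).
Proof.
move=> bg; rewrite /expect /avg big_split /= prodr_const card_ord exprVn.
congr (_ * _); rewrite bigA_distr_bigA; apply: eq_bigr => phi _.
by rewrite (@cubeint_prod R n (fun i s => g i s (phi i))).
Qed.

Definition rot (c : nat) (l : 'I_N) : 'I_N := inord ((l + c) %% N).

Lemma rot_inj c : injective (rot c).
Proof.
move=> i j /(congr1 val); rewrite /rot /= !inordK ?ltn_mod// => /eqP.
rewrite eqn_modDr !modn_small ?ltn_ord// => /eqP; exact: val_inj.
Qed.

Lemma angle_rot c (l : 'I_N) : exists j, angle (rot c l) + j%:R * (2 * pi) =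
  angle l + angle c.
Proof.
exists ((l + c) %/ N)%N; rewrite /rot inordK ?ltn_mod// /angle -mulrDl -natrD.
rewrite [in RHS](divn_eq (l + c) N) natrD natrM; field.
by rewrite addrC natr1 pnatr_eq0.
Qed.

Definition sphere_x (t : R) (s : T) (phi : Phi) : 'I_n -> R :=
  orbit_pt (fun i => disc_rad (tnth s i)) (fun i => angle (phi i)) t.
Definition sphere_y (s : T) (phi : Phi) : 'I_n -> R :=
  orbit_vel (fun i => disc_rad (tnth s i)) (fun i => angle (phi i)) 0.

(** Turning every angle by the same multiple of the step permutes the angles. *)
Lemma expect_rot (F : ('I_n -> R) -> R) c :
  expect (fun s phi => F (sphere_x (angle c) s phi)) =
  expect (fun s phi => F (sphere_x 0 s phi)).
Proof.
rewrite /expect; congr (_ * _).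
have inj : injective (fun phi : Phi => [ffun i => rot c (phi i)]).
  move=> p q /ffunP e; apply/ffunP => i; apply: (@rot_inj c).
  by have := e i; rewrite !ffunE.
rewrite [RHS](reindex_inj inj); apply: eq_bigr => phi _.
apply: eq_cubeint => s _; congr F; apply/funext => i.
rewrite /sphere_x /orbit_pt ffunE addr0.
by have [j <-] := angle_rot c (phi i); rewrite cosDpin.
Qed.

Lemma bm_sphere_x t i : bmE (fun s phi => sphere_x t s phi i).
Proof.
move=> phi; apply: bmeasM; last exact: bmeas_cst.
exact: bmeas_coord (bmeas_rad R).
Qed.

Lemma bm_sphere_y i : bmE (fun s phi => sphere_y s phi i).
Proof.
move=> phi; apply: bmeasN; apply: bmeasM; last exact: bmeas_cst.
exact: bmeas_coord (bmeas_rad R).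
Qed.

Lemma bm_meval_x t (q : mpoly n R) : bmE (fun s phi => meval (sphere_x t s phi) q).
Proof. move=> phi; apply: bmeas_meval => i; exact: bm_sphere_x. Qed.

Let x1 (s : R) (l : 'I_N) := disc_rad s * cos (angle l).
Let y1 (s : R) (l : 'I_N) := - (disc_rad s * sin (angle l)).
Let mom a b := avg (fun l => int1 (fun s => x1 s l ^+ a * y1 s l ^+ b)).
Let nu a := int1 (fun s : R => s ^+ a).

Let bm_radX a : bmeas J ((fun s => disc_rad s ^+ a) : measurableTypeR R -> R).
Proof. by apply: bmeasX; exact: bmeas_rad. Qed.

(** [mom a b] is the moment of order [(a, b)] of one pair [(x_j, y_j)]; averages of
    products over the coordinates factor into these by [expect_prod]. *)
Let momE a b : mom a b =
  avg (fun l : 'I_N => cos (angle l) ^+ a * (- sin (angle l)) ^+ b) *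
  int1 (fun s => disc_rad s ^+ (a + b)).
Proof.
rewrite /mom /avg -[RHS]mulrA; congr (_ * _); rewrite mulr_suml;
  apply: eq_bigr => l _.
rewrite -int1Z; last exact: bm_radX.
apply: eq_Rintegral => s _.
by rewrite /x1 /y1 -mulrN !exprMn exprD; ring.
Qed.

Let mom0 a : (a < N)%N -> mom a 0 = nu a.
Proof.
move=> aN; rewrite momE addn0 -[RHS](avg_moment _ aN); congr (_ * _).
by rewrite /avg; congr (_ * _); apply: eq_bigr => l _; rewrite expr0 mulr1.
Qed.

Let mom1 a : (a.+1 < N)%N -> mom a 1 = 0.
Proof.
move=> aN; rewrite momE.
have -> : avg (fun l : 'I_N => cos (angle l) ^+ a * (- sin (angle l)) ^+ 1) = 0;
  last by rewrite mul0r.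
have := avg_cosX_sin R aN; rewrite /avg => /eqP; rewrite mulf_eq0 => /orP[|/eqP e].
  by rewrite invr_eq0 pnatr_eq0.
rewrite (eq_bigr (fun l : 'I_N => - (cos (angle l) ^+ a * sin (angle l)))) => [|l _].
  by rewrite sumrN e oppr0 mulr0.
by rewrite expr1 mulrN.
Qed.

Let mom2 a : (a.+2 < N)%N -> mom a 2 = 2^-1 * (nu a - nu a.+2).
Proof.
move=> aN; rewrite momE addn2.
have -> : avg (fun l : 'I_N => cos (angle l) ^+ a * (- sin (angle l)) ^+ 2) =
    avg (fun l : 'I_N => cos (angle l) ^+ a) - avg (fun l : 'I_N =>
      cos (angle l) ^+ a.+2).
  rewrite /avg -mulrBr -sumrB; congr (_ * _); apply: eq_bigr => l _.
  by rewrite sqrrN sin2cos2 !exprS; ring.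
have e1 := avg_cosSS R aN.
have e2 : a.+3%:R * nu a.+2 = a.+1%:R * nu a.
  exact: int1_momentSS.
have e3 := avg_moment R aN.
move: e1 e2 e3; rewrite /nu -!/(nu _).
set k := avg _; set k' := avg _; set I2 := int1 _ => e1 e2 e3.
have -> : nu a = a.+3%:R / a.+1%:R * nu a.+2.
  by apply: (@mulfI _ a.+1%:R); rewrite ?pnatr_eq0// -e2; field;
    rewrite addrC natr1 pnatr_eq0.
have -> : k' = a.+2%:R / a.+1%:R * k.
  by apply: (@mulfI _ a.+1%:R); rewrite ?pnatr_eq0// -e1; field;
    rewrite addrC natr1 pnatr_eq0.
have a1 : a.+1%:R != 0 :> R by rewrite pnatr_eq0.
by rewrite -e3 -[a.+3%:R]natr1 -[a.+2%:R]natr1; field.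
Qed.

Let prod_delta (v : 'I_n -> R) i : \prod_l v l ^+ (i == l) = v i.
Proof.
rewrite (bigD1 i)//= eqxx expr1 big1 ?mulr1// => l li.
by rewrite eq_sym (negPf li) expr0.
Qed.

Let bm_mom (a b : 'I_n -> nat) i l :
  bmeas J ((fun s => x1 s l ^+ a i * y1 s l ^+ b i) : measurableTypeR R -> R).
Proof.
apply: bmeasM; apply: bmeasX; first by apply: bmeasM;
  [exact: bmeas_rad|exact: bmeas_cst].
by apply: bmeasN; apply: bmeasM; [exact: bmeas_rad|exact: bmeas_cst].
Qed.

Let expect_monomial (a b : 'I_n -> nat) :
  expect (fun s phi => (\prod_i sphere_x 0 s phi i ^+ a i) *
    \prod_i sphere_y s phi i ^+ b i) =
  \prod_i mom (a i) (b i).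
Proof.
rewrite -(expect_prod (bm_mom a b)); apply: eq_expect => s phi _.
rewrite -big_split /=; apply: eq_bigr => i _.
by rewrite /sphere_x /sphere_y /orbit_pt /orbit_vel !addr0.
Qed.

Lemma cubeint_monomial (a : 'I_n -> nat) :
  cubeint (fun s : T => \prod_i tnth s i ^+ a i) = \prod_i nu (a i).
Proof.
rewrite (@cubeint_prod R n (fun i (t : R) => t ^+ a i))// => i.
by apply: bmeasX; exact: bmeas_id.
Qed.

Lemma bm_peval (q : mpoly n R) : bm (peval q).
Proof.
by apply: bmeas_meval => i; apply: (@bmeas_coord R n i id); exact: bmeas_id.
Qed.

Lemma bm_cube_monomial (m : multinom n) : bm (fun s : T => \prod_i tnth s i ^+ m i).
Proof.
apply: bmeas_prod => i; apply: (@bmeas_coord R n i (fun t => t ^+ m i)).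
by apply: bmeasX; exact: bmeas_id.
Qed.

Let cubeint_pevalE (q : mpoly n R) :
  cubeint (peval q) = \sum_(m <- msupp q) mcoeff m q * \prod_i nu (m i).
Proof.
under eq_bigr do rewrite -cubeint_monomial.
rewrite /peval; under [in LHS]eq_cubeint do rewrite mevalE.
rewrite cubeint_sum => [|m].
  by apply: eq_bigr => m _; rewrite cubeintZ//; exact: bm_cube_monomial.
by apply: bmeasM; [exact: bmeas_cst|exact: bm_cube_monomial].
Qed.

Let mono_lt (q : mpoly n R) m i : m \in msupp q -> (m i < mmeasure mdeg q)%N.
Proof.
move=> mq; apply: leq_ltn_trans (msize_mdeg_lt mq).
by rewrite mdegE (bigD1 i)//= leq_addr.
Qed.

Let bm_xy_monomial (a b : 'I_n -> nat) :
  bmE (fun s phi => (\prod_i sphere_x 0 s phi i ^+ a i) *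
    \prod_i sphere_y s phi i ^+ b i).
Proof.
move=> phi; apply: bmeasM; apply: bmeas_prod => i; apply: bmeasX.
  exact: bm_sphere_x.
exact: bm_sphere_y.
Qed.

Let expect_meval (q : mpoly n R) (b : 'I_n -> nat) :
  expect (fun s phi => meval (sphere_x 0 s phi) q * \prod_i sphere_y s phi i ^+ b i) =
  \sum_(m <- msupp q) mcoeff m q * \prod_i mom (m i) (b i).
Proof.
under eq_bigr do rewrite -expect_monomial.
rewrite -[RHS](_ : expect (fun s phi => \sum_(m <- msupp q) mcoeff m q *
  ((\prod_i sphere_x 0 s phi i ^+ m i) * \prod_i sphere_y s phi i ^+ b i)) = _).
  by apply: eq_expect => s phi _; rewrite mevalE mulr_suml; apply: eq_bigr => m _;
    rewrite mulrA.
rewrite expect_sum => [|m phi]; first by apply: eq_bigr => m _; rewrite expectZ//;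
  exact: bm_xy_monomial.
by apply: bmeasM; [exact: bmeas_cst|exact: bm_xy_monomial].
Qed.

(** The vector [x] is uniform on the cube, as far as polynomials of degree less
    than [N] can tell. *)
Lemma expect_x (q : mpoly n R) : (mmeasure mdeg q <= N)%N ->
  expect (fun s phi => meval (sphere_x 0 s phi) q) = cubeint (peval q).
Proof.
move=> qN; transitivity (expect (fun s phi => meval (sphere_x 0 s phi) q *
    \prod_(i < n) sphere_y s phi i ^+ 0)).
  by apply: eq_expect => s phi _; rewrite big1 ?mulr1// => i _; rewrite expr0.
rewrite (expect_meval _ (fun=> 0%N)) cubeint_pevalE big_seq [RHS]big_seq.
apply: eq_bigr => m mq; congr (_ * _); apply: eq_bigr => i _.
by rewrite mom0// (leq_trans (mono_lt i mq)).
Qed.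

(** Given [x], the [y_j] are uncorrelated, with variance [(1 - x_j^2) / 2]. *)
Lemma expect_xyy (q : mpoly n R) i j : ((mmeasure mdeg q).+2 <= N)%N ->
  expect (fun s phi => meval (sphere_x 0 s phi) q * (sphere_y s phi i *
    sphere_y s phi j)) =
  if i == j then 2^-1 * cubeint (fun s : T => (1 - tnth s i ^+ 2) * peval q s) else 0.
Proof.
move=> qN; transitivity (expect (fun s phi => meval (sphere_x 0 s phi) q *
    \prod_(l < n) sphere_y s phi l ^+ ((i == l) + (j == l)))).
  apply: eq_expect => s phi _; congr (_ * _).
  under eq_bigr do rewrite exprD.
  by rewrite big_split /= !prod_delta.
rewrite (expect_meval _ (fun l => (i == l) + (j == l))%N).
case: eqVneq => [<-|ij]; last first.
  rewrite big_seq big1// => m mq;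
    rewrite (bigD1 i)//= eqxx eq_sym (negPf ij) addn0 mom1 ?mul0r ?mulr0//.
  by have := mono_lt i mq; move: qN; lia.
have -> : cubeint (fun s : T => (1 - tnth s i ^+ 2) * peval q s) =
    \sum_(m <- msupp q) mcoeff m q * ((nu (m i) - nu (m i).+2) *
      \prod_(l | l != i) nu (m l)).
  pose m2 (m : multinom n) l := (m l + 2 * (i == l))%N.
  have bm2 m : bm (fun s : T => \prod_l tnth s l ^+ m2 m l).
    apply: bmeas_prod => l; apply: (@bmeas_coord R n l (fun t => t ^+ m2 m l)).
    by apply: bmeasX; exact: bmeas_id.
  transitivity (cubeint (fun s : T => \sum_(m <- msupp q) mcoeff m q *
      (\prod_l tnth s l ^+ m l + -1 * \prod_l tnth s l ^+ m2 m l))).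
    apply: eq_cubeint => s _; rewrite /peval mevalE mulr_sumr; apply: eq_bigr => m _.
    rewrite mulrCA; congr (_ * _).
    rewrite /m2; under [X in -1 * X]eq_bigr do rewrite exprD exprM.
    have e := prod_delta (fun l => tnth s l ^+ 2) i.
    by rewrite big_split /= e; ring.
  rewrite cubeint_sum => [|m]; last first.
    apply: bmeasM; first exact: bmeas_cst.
    apply: bmeasD; first exact: bm_cube_monomial.
    by apply: bmeasM; first exact: bmeas_cst.
  apply: eq_bigr => m _; rewrite cubeintZ; last first.
    apply: bmeasD; first exact: bm_cube_monomial.
    by apply: bmeasM; first exact: bmeas_cst.
  rewrite cubeintD; [|exact: bm_cube_monomial|by apply: bmeasM;
    first exact: bmeas_cst].
  rewrite cubeintZ// !cubeint_monomial (bigD1 i)//= [X in -1 *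
    X](bigD1 i)//= /m2 eqxx muln1 addn2.
  rewrite [X in -1 * (_ * X)](eq_bigr (fun l => nu (m l))) => [|l li]; first by ring.
  by rewrite eq_sym (negPf li) muln0 addn0.
rewrite mulr_sumr big_seq [RHS]big_seq; apply: eq_bigr => m mq.
rewrite (bigD1 i)//= eqxx mom2; last by have := mono_lt i mq; move: qN; lia.
rewrite (eq_bigr (fun l => nu (m l))) => [|l li]; first by ring.
rewrite eq_sym (negPf li) addn0 mom0//; have := mono_lt l mq; move: qN; lia.
Qed.

End sphere_expectation.

(** * Bernstein's inequality on the cube *)

Section young.
Context (R : realFieldType).

(** Induction on [k]: the gain at each step is
    [0 <= (a ^+ k.+1 - b ^+ k.+1) * (a - b)]. *)
Lemma young_pow (a b : R) k : 0 <= a -> 0 <= b ->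
  k.+1%:R * (a ^+ k * b) <= k%:R * a ^+ k.+1 + b ^+ k.+1.
Proof.
move=> a0 b0; elim: k => [|k IH]; first by rewrite !expr0 !mul1r mul0r add0r expr1.
have h : 0 <= (a ^+ k.+1 - b ^+ k.+1) * (a - b).
  have [ab|/ltW ba] := leP a b.
    by rewrite mulr_le0// subr_le0// lerXn2r.
  by rewrite mulr_ge0// subr_ge0// lerXn2r.
have := ler_wpM2l a0 IH.
rewrite -[k.+2%:R]natr1 ![_ ^+ k.+2]exprS -[k.+1%:R]natr1.
move: h; rewrite [a ^+ k.+1]exprS.
set x := a ^+ k; set y := b ^+ k.+1; lra.
Qed.

(** Integrating [young_pow] gives such a bound, with the same integral [x] on both
    sides. *)
Lemma young_absorb (x y : R) k : (0 < k)%N -> k%:R * x <= k.-1%:R * x + y -> x <= y.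
Proof. by case: k => // k _; rewrite -natr1 mulrDl mul1r lerD2l. Qed.

(** Convexity of the power [2 k], in the form of Jensen's inequality for the
    probability weights [`|w l| / D]; it follows from [young_pow] applied to
    [`|V|] and [D * `|t l|], so that no division is needed. *)
Lemma weighted_sum_pow n (w t : 'I_n -> R) k (D := \sum_l `|w l|) : (0 < k)%N ->
  D * (\sum_l w l * t l) ^+ (2 * k) <= D ^+ (2 * k) * \sum_l `|w l| * t l ^+ (2 * k).
Proof.
move=> k0; set V := \sum_l _; have D0 : 0 <= D by exact: sumr_ge0.
have [j jE] : exists j, (2 * k = j.+1)%N by exists (2 * k).-1; lia.
have evenX (x : R) : `|x| ^+ (2 * k) = x ^+ (2 * k).
  by rewrite !exprM real_normK ?num_real.
have yl l : `|w l| * (j.+1%:R * (`|V| ^+ j * (D * `|t l|))) <=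
    `|w l| * (j%:R * V ^+ (2 * k) + D ^+ (2 * k) * t l ^+ (2 * k)).
  apply: ler_wpM2l => //.
  have := @young_pow `|V| (D * `|t l|) j (normr_ge0 _) (mulr_ge0 D0 (normr_ge0 _)).
  by rewrite -jE exprMn !evenX.
have : \sum_l `|w l| * (j.+1%:R * (`|V| ^+ j * (D * `|t l|))) <=
  \sum_l `|w l| * (j%:R * V ^+ (2 * k) + D ^+ (2 * k) * t l ^+ (2 * k)).
  by apply: ler_sum => l _; exact: yl.
have -> : \sum_l `|w l| * (j.+1%:R * (`|V| ^+ j * (D * `|t l|))) =
  j.+1%:R * D * `|V| ^+ j * \sum_l `|w l * t l|.
  by rewrite mulr_sumr; apply: eq_bigr => l _; rewrite normrM; ring.
have -> : \sum_l `|w l| * (j%:R * V ^+ (2 * k) + D ^+ (2 * k) * t l ^+ (2 * k)) =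
    D * (j%:R * V ^+ (2 * k)) + D ^+ (2 * k) * \sum_l `|w l| * t l ^+ (2 * k).
  by rewrite mulr_sumr /D mulr_suml -big_split; apply: eq_bigr => l _ /=; ring.
have : j.+1%:R * D * `|V| ^+ j * `|V| <=
  j.+1%:R * D * `|V| ^+ j * \sum_l `|w l * t l|.
  apply: ler_wpM2l; first by rewrite !mulr_ge0// exprn_ge0.
  exact: ler_norm_sum.
rewrite -mulrA -exprSr -jE evenX jE -natr1; lra.
Qed.
End young.

Section bernstein.
Context (R : realType) (n : nat).
Local Notation T := (n.-tuple (measurableTypeR R)).

Local Notation bm := (@bmeas _ T R (cube R n)).

Definition pint (q : mpoly n R) : R := cubeint (peval q : T -> R).

Lemma pintD p q : pint (p + q) = pint p + pint q.
Proof.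
rewrite /pint -cubeintD; [|exact: bm_peval..].
by apply: eq_cubeint => s _; rewrite /peval mevalD.
Qed.

Lemma pintZ c q : pint (c *: q) = c * pint q.
Proof.
rewrite /pint -cubeintZ; last exact: bm_peval.
by apply: eq_cubeint => s _; rewrite /peval mevalZ.
Qed.

Lemma pint_sum I (r : seq I) (P : pred I) (F : I -> mpoly n R) :
  pint (\sum_(i <- r | P i) F i) = \sum_(i <- r | P i) pint (F i).
Proof.
elim: r => [|i r IH]; last by rewrite !big_cons; case: (P i); rewrite ?pintD IH.
by rewrite !big_nil -[0 in LHS](scale0r 0) pintZ mul0r.
Qed.

Lemma le_pint p q : (forall s : T, cube R n s -> peval p s <= peval q s) ->
  pint p <= pint q.
Proof. by move=> pq; apply: le_cubeint => //; exact: bm_peval. Qed.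

Definition weight_poly (j : 'I_n) : mpoly n R := 1 - mpolyX R (mnm1 j) ^+ 2.
Definition wgrad_poly (f : mpoly n R) : mpoly n R :=
  \sum_j weight_poly j * mderiv j f ^+ 2.

Lemma meval_weight v j : meval v (weight_poly j) = 1 - v j ^+ 2.
Proof. by rewrite mevalB meval1 rmorphXn /= mevalXU. Qed.

Lemma meval_wgrad v f :
  meval v (wgrad_poly f) = \sum_j (1 - v j ^+ 2) * meval v (mderiv j f) ^+ 2.
Proof.
rewrite raddf_sum /=; apply: eq_bigr => j _.
by rewrite mevalM meval_weight rmorphXn.
Qed.

Lemma peval_wgrad f : peval (wgrad_poly f) = weighted_sqgrad f :> (T -> R).
Proof. by apply/funext => s; rewrite /peval meval_wgrad. Qed.

Lemma meval_wgrad_ge0 v f : (forall i, `|v i| <= 1) -> 0 <= meval v (wgrad_poly f).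
Proof.
move=> v1; rewrite meval_wgrad sumr_ge0// => j _; rewrite mulr_ge0 ?sqr_ge0//.
by rewrite subr_ge0 -real_normK ?num_real// expr_le1.
Qed.

Lemma sphere_x_le1 N' t (s : T) phi i : `|@sphere_x R n N' t s phi i| <= 1.
Proof.
rewrite /sphere_x /orbit_pt normrM mulr_ile1 ?cos_max//.
rewrite /disc_rad ger0_norm ?sqrtr_ge0// -[leRHS]sqrtr1 ler_wsqrtr//.
by rewrite gerBl sqr_ge0.
Qed.

(** The number [N'.+1] of angles is a multiple of [4 d], to make the Riesz nodes
    multiples of the angular step, and exceeds the degrees of all the polynomials
    whose averages have to be exact. *)
Lemma bernstein_cube d k (f : mpoly n R) : (0 < d)%N -> (0 < k)%N ->
  (mmeasure mdeg f <= d.+1)%N ->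
  pint (wgrad_poly f ^+ k) <= (2 * d%:R ^+ 2) ^+ k * pint (f ^+ (2 * k)).
Proof.
move=> d0 k0 fd; rewrite /pint.
pose A := 2^-1 *: wgrad_poly f; pose q i j := A ^+ k.-1 * (mderiv i f * mderiv j f).
pose fk := f ^+ (2 * k); pose Ak := A ^+ k.
pose K := (2 + mmeasure mdeg fk + mmeasure mdeg Ak +
  \sum_i \sum_j mmeasure mdeg (q i j))%N.
have [N' N'E] : exists N', (N'.+1 = d.*2 * 2 * K)%N by exists (d.*2 * 2 * K).-1;
  rewrite prednK//; lia.
have KN : (K <= N'.+1)%N by rewrite N'E leq_pmull//; lia.
have fN : (mmeasure mdeg fk <= N'.+1)%N by apply: leq_trans KN; rewrite /K; lia.
have AN : (mmeasure mdeg Ak <= N'.+1)%N by apply: leq_trans KN; rewrite /K; lia.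
pose E := @expect R n N'.
pose V (s : T) phi :=
  \sum_j @sphere_y R n N' s phi j * meval (sphere_x 0 s phi) (mderiv j f).
have bV : bmE V.
  move=> phi; apply: bmeas_sum => j; apply: bmeasM; first exact: bm_sphere_y.
  exact: bm_meval_x.
have nodeE l : riesz_node R d l = angle R N' (l.*2.+1 * K).
  rewrite /riesz_node /angle N'E !natrM.
  have K0 : K%:R != 0 :> R by rewrite pnatr_eq0 /K; lia.
  have d2 : d.*2%:R != 0 :> R by rewrite pnatr_eq0; lia.
  by field; rewrite K0 d2.
have VE s phi : V s phi = \sum_(l < d.*2) riesz_weight R d l *
    meval (@sphere_x R n N' (angle R N' (l.*2.+1 * K)) s phi) f.
  rewrite /V /sphere_x /sphere_y.
  rewrite -(riesz_interpolation d0 0 (trig_pair_meval _ _ fd)).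
  by apply: eq_bigr => l _; rewrite add0r nodeE.
have bX t k' : bmE (fun s phi => meval (@sphere_x R n N' t s phi) f ^+ k').
  by move=> phi; apply: bmeasX; exact: bm_meval_x.
(* All the terms of the interpolation formula have the same law as [f(x)]. *)
have EV : E (fun s phi => V s phi ^+ (2 * k)) <=
    d%:R ^+ (2 * k) * cubeint (peval (f ^+ (2 * k)) : T -> R).
  have d0R : 0 < d%:R :> R by rewrite ltr0n.
  rewrite -(ler_pM2l d0R).
  have <- : E (fun s phi => d%:R * V s phi ^+ (2 * k)) = d%:R * E (fun s phi =>
    V s phi ^+ (2 * k)).
    by apply: expectZ => phi; exact: bmeasX.
  apply: (@le_trans _ _ (E (fun s phi =>
    d%:R ^+ (2 * k) * \sum_(l < d.*2) `|riesz_weight R d l| *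
    meval (@sphere_x R n N' (angle R N' (l.*2.+1 * K)) s phi) f ^+ (2 * k)))).
    apply: le_expect => [phi|phi|s phi _].
    - by apply: bmeasM; [exact: bmeas_cst|exact: bmeasX].
    - apply: bmeasM; first exact: bmeas_cst.
      by apply: bmeas_sum => l; apply: bmeasM; [exact: bmeas_cst|exact: bX].
    rewrite VE -{1 2}(sum_norm_riesz_weight R d0); exact: weighted_sum_pow.
  rewrite /E expectZ; last first.
    by move=> phi; apply: bmeas_sum => l; apply: bmeasM; [exact: bmeas_cst|exact: bX].
  rewrite expect_sum; last by move=> l phi; apply: bmeasM;
    [exact: bmeas_cst|exact: bX].
  rewrite mulrCA ler_wpM2l// ?exprn_ge0//.
  rewrite (eq_bigr (fun l : 'I_d.*2 =>
    `|riesz_weight R d l| * cubeint (peval (f ^+ (2 * k)) : T -> R))).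
    by rewrite -mulr_suml sum_norm_riesz_weight.
  move=> l _; rewrite expectZ; last exact: bX.
  rewrite (@expect_rot R n N' (fun v => meval v f ^+ (2 * k))) -(@expect_x R n N');
    last exact: fN.
  by congr (_ * _); apply: eq_expect => s phi _; rewrite rmorphXn.
(* One factor [A] is traded for [V^2], their conditional means being equal. *)
have AE v : meval v A = 2^-1 * meval v (wgrad_poly f) by rewrite mevalZ.
have EA : E (fun s phi => meval (@sphere_x R n N' 0 s phi) A ^+ k) =
    E (fun s phi => meval (@sphere_x R n N' 0 s phi) A ^+ k.-1 * V s phi ^+ 2).
  have -> : E (fun s phi => meval (@sphere_x R n N' 0 s phi) A ^+ k) =
    cubeint (peval (A ^+ k) : T -> R).
    rewrite -(@expect_x R n N'); last exact: AN.
    by apply: eq_expect => s phi _; rewrite rmorphXn.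
  have -> : E (fun s phi =>
    meval (@sphere_x R n N' 0 s phi) A ^+ k.-1 * V s phi ^+ 2) =
    E (fun s phi => \sum_i \sum_j meval (sphere_x 0 s phi) (q i j) *
      (sphere_y s phi i * sphere_y s phi j)).
    apply: eq_expect => s phi _; rewrite expr2 /V mulr_suml mulr_sumr;
      apply: eq_bigr => i _.
    rewrite mulr_sumr mulr_sumr; apply: eq_bigr => j _.
    by rewrite !mevalM rmorphXn /=; ring.
  have bq i j : bmE (fun s phi =>
    meval (@sphere_x R n N' 0 s phi) (q i j) * (sphere_y s phi i * sphere_y s phi j)).
    move=> phi; apply: bmeasM; first exact: bm_meval_x.
    by apply: bmeasM; exact: bm_sphere_y.
  rewrite /E expect_sum => [|i phi]; last by apply: bmeas_sum => j; exact: bq.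
  rewrite (eq_bigr (fun i => 2^-1 * cubeint (fun s : T =>
    (1 - tnth s i ^+ 2) * peval (q i i) s))) => [|i _].
    have bw i : bm (fun s : T => (1 - tnth s i ^+ 2) * peval (q i i) s).
      apply: bmeasM; last exact: bm_peval.
      apply: bmeasD; first exact: bmeas_cst.
      apply: bmeasN; apply: (@bmeas_coord R n i (fun t => t ^+ 2)).
      by apply: bmeasX; exact: bmeas_id.
    transitivity (\sum_i cubeint (fun s : T =>
      2^-1 * ((1 - tnth s i ^+ 2) * peval (q i i) s))).
      rewrite -cubeint_sum => [|i]; last by apply: bmeasM;
        [exact: bmeas_cst|exact: bw].
      apply: eq_cubeint => s _;
        rewrite /peval rmorphXn /= -{1}(prednK k0) exprSr {2}AE.
      rewrite meval_wgrad !mulr_sumr; apply: eq_bigr => i _.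
      by rewrite !mevalM rmorphXn /=; ring.
    by apply: eq_bigr => i _; rewrite cubeintZ.
  rewrite expect_sum; last exact: bq.
  have qN j : ((mmeasure mdeg (q i j)).+2 <= N'.+1)%N.
    apply: leq_trans KN; rewrite /K (bigD1 i)//= (bigD1 j)//=; lia.
  rewrite (bigD1 i)//= expect_xyy// eqxx big1 ?addr0// => j ji.
  by rewrite expect_xyy// eq_sym (negPf ji).
pose EAk := E (fun s phi => meval (@sphere_x R n N' 0 s phi) A ^+ k).
have yng : k%:R * EAk <= k.-1%:R * EAk + E (fun s phi => V s phi ^+ (2 * k)).
  rewrite {1}/EAk EA /EAk /E.
  have bA j : bmE (fun s phi => meval (@sphere_x R n N' 0 s phi) A ^+ j).
    by move=> phi; apply: bmeasX; exact: bm_meval_x.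
  have bVj j : bmE (fun s phi => V s phi ^+ j) by move=> phi; exact: bmeasX.
  have bAV : bmE (fun s phi =>
    meval (@sphere_x R n N' 0 s phi) A ^+ k.-1 * V s phi ^+ 2).
    by move=> phi; apply: bmeasM; [exact: bA|exact: bVj].
  have bA' : bmE (fun s phi => k.-1%:R * meval (@sphere_x R n N' 0 s phi) A ^+ k).
    by move=> phi; apply: bmeasM; [exact: bmeas_cst|exact: bA].
  rewrite -!expectZ// -expectD//.
  apply: le_expect => [phi|phi|s phi _].
  - by apply: bmeasM; [exact: bmeas_cst|exact: bAV].
  - by apply: bmeasD; [exact: bA'|exact: bVj].
  have A0 : 0 <= meval (@sphere_x R n N' 0 s phi) A.
    by rewrite AE mulr_ge0 ?invr_ge0// meval_wgrad_ge0// => i; exact: sphere_x_le1.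
  by have := young_pow k.-1 A0 (sqr_ge0 (V s phi)); rewrite prednK// -exprM.
have EAV : EAk <= d%:R ^+ (2 * k) * cubeint (peval (f ^+ (2 * k)) : T -> R).
  by apply: le_trans EV; exact: young_absorb yng.
have EAE : EAk = 2^-1 ^+ k * cubeint (peval (wgrad_poly f ^+ k) : T -> R).
  have -> : EAk = cubeint (peval Ak : T -> R).
    rewrite -(@expect_x R n N'); last exact: AN.
    by apply: eq_expect => s phi _; rewrite rmorphXn.
  rewrite -cubeintZ; last exact: bm_peval.
  by apply: eq_cubeint => s _; rewrite /peval !rmorphXn /= AE exprMn.
have c0 : 0 < 2^-1 ^+ k :> R by rewrite exprn_gt0.
rewrite -(ler_pM2l c0) -EAE (le_trans EAV)// exprMn mulrA mulrA -exprMn mulVf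
  ?pnatr_eq0//.
by rewrite expr1n mul1r -exprM.
Qed.
End bernstein.

(** * Markov's inequality on the cube *)

Section degree.
Context (R : realType) (n : nat).
Implicit Types p q : mpoly n R.

Lemma msizeM_leS p q a b : (mmeasure mdeg p <= a.+1)%N -> (mmeasure mdeg q <=
  b.+1)%N ->
  (mmeasure mdeg (p * q) <= (a + b).+1)%N.
Proof.
move=> pa qb; have [->|p0] := eqVneq p 0; first by rewrite mul0r mmeasure0.
have [->|q0] := eqVneq q 0; first by rewrite mulr0 mmeasure0.
rewrite msizeM// -subn1 leq_subLR add1n.
by apply: leq_trans (leq_add pa qb) _; rewrite addSn addnS.
Qed.

Lemma msize_mderiv_le p i d : (mmeasure mdeg p <= d.+1)%N ->
  (mmeasure mdeg (mderiv i p) <= d)%N.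
Proof.
move=> pd; rewrite [p]mpolyE raddf_sum /= big_seq.
elim/big_ind: _ => [|u v ud vd|m mp]; first by rewrite mmeasure0.
  by apply: leq_trans (mmeasureD_le _ _ _) _; rewrite geq_max ud.
rewrite mderivZ mderivX; case: (posnP (m i)) => [->|mi].
  by rewrite scale0r scaler0 mmeasure0.
do 2!apply: leq_trans (msizeZ_le _ _) _; rewrite msizeX.
have mE : m = mnm_add (mnm_sub m (mnm1 i)) (mnm1 i).
  by rewrite submK//; apply/mnm_lepP => j; rewrite mnm1E; case: eqP => [<-|].
have := leq_trans (msize_mdeg_lt mp) pd.
by rewrite {1}mE mdegD mdeg1 addn1.
Qed.
End degree.

Section markov.
Context (R : realType) (n : nat).
Local Notation T := (n.-tuple (measurableTypeR R)).

Lemma pint_monomial (m : multinom n) :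
  pint (mpolyX R m) = \prod_i int1 (fun t : R => t ^+ m i).
Proof. by rewrite -cubeint_monomial; apply: eq_cubeint => s _;
  rewrite /peval mevalX. Qed.

(** The weight vanishes on the two faces [x_j = 1] and [x_j = -1]. *)
Lemma pint_by_parts j (q : mpoly n R) : pint (mderiv j (weight_poly R j * q)) = 0.
Proof.
rewrite [q]mpolyE mulr_sumr raddf_sum /= pint_sum big1// => m _.
rewrite -scalerAr mderivZ pintZ; apply/eqP; rewrite mulf_eq0; apply/orP; right;
  apply/eqP.
rewrite /weight_poly mpolyXn mulrBl mul1r -mpolyXD mderivB !mderivX.
rewrite -!scaleNr pintD !pintZ !pint_monomial.
set nu := fun a => int1 (fun t : R => t ^+ a).
rewrite (bigD1 j)//= [X in _ + _ * X](bigD1 j)//=.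
rewrite [X in _ + _ * (_ * X)](eq_bigr (fun l => nu (m l))) => [|l lj]; last first.
  by rewrite mnmBE mnmDE mulmnE !mnm1E eq_sym (negPf lj) subn0.
rewrite [X in _ * (_ * X) + _](eq_bigr (fun l => nu (m l))) => [|l lj]; last first.
  by rewrite mnmBE mnm1E eq_sym (negPf lj) subn0.
rewrite !mnmBE mnmDE mulmnE !mnm1E eqxx.
case: (m j) => [|a].
  have -> : int1 (fun t : R => t ^+ (1 * 2 + 0 - 1)) = 0.
    by rewrite int1_moment /= expr1 subrr mul0r.
  ring.
have -> : (1 * 2 + a.+1 - 1 = a.+2)%N by lia.
have -> : (1 * 2 + a.+1 = a.+3)%N by lia.
by rewrite subn1 /= mulrA mulNr mulrA (int1_momentSS R); ring.
Qed.

(** With [w = 1 - x_j^2], integrating the [j]-th derivative of [w x_j p^2] gives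
    [2 \int p^2 = 3 \int w p^2 + 2 \int w x_j p (d_j p)].  The cross term is
    controlled by [\int w (d_j p)^2], which Bernstein's inequality with [k = 1]
    bounds by [2 N^2 \int p^2]. *)
Lemma pint_le_weighted j N (p : mpoly n R) :
  (0 < N)%N -> (mmeasure mdeg p <= N.+1)%N ->
  pint (p ^+ 2) <= (3 + 2 * N%:R ^+ 2) * pint (weight_poly R j * p ^+ 2).
Proof.
move=> N0 pN; set G := pint _; set W := pint (_ * _).
pose H := pint (weight_poly R j * mderiv j p ^+ 2).
pose X := mpolyX R (mnm1 j).
pose c : R := 2 * N%:R ^+ 2.
have c0 : 0 < c by rewrite mulr_gt0// exprn_gt0// ltr0n.
have HG : H <= c * G.
  have := @bernstein_cube R n N 1 p N0 isT pN; rewrite !expr1 muln1; apply: le_trans.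
  apply: le_pint => s sc; rewrite /peval meval_wgrad mevalM meval_weight rmorphXn /=.
  rewrite (bigD1 j)//= lerDl sumr_ge0// => i _; rewrite mulr_ge0 ?sqr_ge0//.
  rewrite subr_ge0 -real_normK ?num_real// expr_le1//.
  by have := sc i; rewrite in_itv /= ler_norml.
have parts : 2 * G = 3 * W + 2 * pint (X * weight_poly R j * p * mderiv j p).
  have := pint_by_parts j (X * p ^+ 2).
  have -> : mderiv j (weight_poly R j * (X * p ^+ 2)) =
     3 *: (weight_poly R j * p ^+ 2) - 2 *: (p ^+ 2) +
     2 *: (X * weight_poly R j * p * mderiv j p).
    rewrite /weight_poly -/X !expr2 !mderivM mderivB mderivM.
    have -> : mderiv j X = 1.
      rewrite /X mderivX mnm1E eqxx scale1r.
      have -> : mnm_sub (mnm1 j) (mnm1 j) = mnm0 :> multinom n.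
        by apply/mnmP => k; rewrite mnmBE subnn mnm0E.
      by rewrite mpolyX0.
    have -> : mderiv j (1 : mpoly n R) = 0 by exact: (mderivC _ 1).
    rewrite -!mul_mpolyC.
    rewrite !rmorph_nat.
    ring.
  rewrite -scaleNr !pintD !pintZ -/W -/G; lra.
have cross : 2 * pint (X * weight_poly R j * p * mderiv j p) <= c * W + c^-1 * H.
  rewrite /W /H -!pintZ -pintD; apply: le_pint => s sc.
  rewrite /peval mevalD !mevalZ !mevalM meval_weight /= mevalXU -!expr2.
  set x := tnth s j; set u := meval _ p; set v := meval _ (mderiv j p).
  have w0 : 0 <= 1 - x ^+ 2.
    rewrite subr_ge0 -real_normK ?num_real// expr_le1//.
    by have := sc j; rewrite in_itv /= ler_norml.
  rewrite -subr_ge0.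
  have -> : c * ((1 - x ^+ 2) * u ^+ 2) + c^-1 * ((1 - x ^+ 2) * v ^+ 2) -
      2 * (x * (1 - x ^+ 2) * u * v) =
    c^-1 * (1 - x ^+ 2) * ((c * u * x - v) ^+ 2 + c ^+ 2 * u ^+ 2 * (1 - x ^+ 2)).
    by field; rewrite gt_eqF.
  rewrite mulr_ge0 ?addr_ge0 ?sqr_ge0//; first by rewrite mulr_ge0// invr_ge0 ltW.
  by rewrite mulr_ge0// mulr_ge0 ?sqr_ge0.
have : c^-1 * H <= G by rewrite mulrC ler_pdivrMr// mulrC.
move: parts cross; rewrite -/c; lra.
Qed.

(** Expanding one factor [\sum_i g i ^+ 2] turns [p ^+ 2] into the squares
    [(p * g i) ^+ 2], of degree larger by [d]; after [e] steps only plain squares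
    are left. *)
Lemma pint_sos_le_weighted (I : finType) (g : I -> mpoly n R)
    j N D d e (p : mpoly n R) :
  (0 < N)%N -> (forall i, (mmeasure mdeg (g i) <= d.+1)%N) ->
  (mmeasure mdeg p <= D.+1)%N -> (D + e * d <= N)%N ->
  pint (p ^+ 2 * (\sum_i g i ^+ 2) ^+ e) <=
  (3 + 2 * N%:R ^+ 2) * pint (weight_poly R j * p ^+ 2 * (\sum_i g i ^+ 2) ^+ e).
Proof.
move=> N0 gd; elim: e D p => [|e IH] D p pD DN.
  rewrite expr0 !mulr1; apply: pint_le_weighted => //.
  by apply: leq_trans pD _; move: DN; lia.
have split_sos (u : mpoly n R) : u * p ^+ 2 * (\sum_i g i ^+ 2) ^+ e.+1 =
    \sum_i u * (p * g i) ^+ 2 * (\sum_i g i ^+ 2) ^+ e.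
  rewrite [_ ^+ e.+1]exprS mulrA mulr_sumr mulr_suml; apply: eq_bigr => i _.
  by rewrite exprMn !mulrA.
have := split_sos 1; rewrite mul1r => ->; rewrite split_sos !pint_sum mulr_sumr.
apply: ler_sum => i _; rewrite mul1r; apply: (IH (D + d)%N).
  exact: msizeM_leS.
by move: DN; rewrite mulSn; lia.
Qed.

Definition sqgrad_poly (f : mpoly n R) : mpoly n R := \sum_j mderiv j f ^+ 2.

Lemma meval_sqgrad v f : meval v (sqgrad_poly f) = \sum_j meval v (mderiv j f) ^+ 2.
Proof. by rewrite raddf_sum /=; apply: eq_bigr => j _; rewrite rmorphXn. Qed.

(** [pint_sos_le_weighted] is applied to each term [(d_j f)^2 F^(k-1)] of [F^k],
    with the same [N = k d] for all [j], so that the weighted terms add up to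
    [G F^(k-1)]; Young's inequality then separates [G] from [F]. *)
Lemma markov_cube d k (f : mpoly n R) : (0 < d)%N -> (0 < k)%N ->
  (mmeasure mdeg f <= d.+1)%N ->
  pint (sqgrad_poly f ^+ k) <=
    (10 * k%:R ^+ 2 * d%:R ^+ 4) ^+ k * pint (f ^+ (2 * k)).
Proof.
have le5 (z : R) : 1 <= z -> 3 + 2 * z <= 5 * z by lra.
move=> d0 k0 fd; pose F := sqgrad_poly f; pose W := wgrad_poly f.
have kd0 : (0 < k * d)%N by rewrite muln_gt0 k0.
pose C : R := 3 + 2 * (k * d)%:R ^+ 2.
have C0 : 0 <= C by rewrite addr_ge0// mulr_ge0// exprn_ge0.
have F0 s : 0 <= peval F s by rewrite /peval meval_sqgrad sumr_ge0// => j _;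
  exact: sqr_ge0.
have W0 (s : T) : cube R n s -> 0 <= peval W s.
  move=> sc; apply: meval_wgrad_ge0 => i.
  by have := sc i; rewrite in_itv /= ler_norml.
have gd i : (mmeasure mdeg (mderiv i f) <= d.-1.+1)%N.
  by rewrite prednK// msize_mderiv_le.
have FW : pint (F ^+ k) <= C * pint (W * F ^+ k.-1).
  rewrite -[in F ^+ k](prednK k0) exprS {1}/F /W /sqgrad_poly /wgrad_poly.
  rewrite !mulr_suml !pint_sum mulr_sumr; apply: ler_sum => j _.
  apply: (@pint_sos_le_weighted _ (fun j => mderiv j f) j _ d.-1 d.-1) => //.
  by rewrite -mulSn prednK// leq_mul// leq_pred.
have young_int : k%:R * (C * pint (W * F ^+ k.-1)) <=
    k.-1%:R * pint (F ^+ k) + C ^+ k * pint (W ^+ k).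
  rewrite -!pintZ -pintD; apply: le_pint => s sc.
  have := young_pow k.-1 (F0 s) (mulr_ge0 C0 (W0 s sc)).
  rewrite prednK// exprMn /peval mevalD !mevalZ mevalM !rmorphXn /=; apply: le_trans.
  move: (meval _ W) (meval _ F ^+ _) => w v.
  by rewrite [v * _]mulrC -mulrA.
have FWk : pint (F ^+ k) <= C ^+ k * pint (W ^+ k).
  by apply: young_absorb k0 _; apply: le_trans young_int; exact: ler_wpM2l.
apply: le_trans FWk _;
  apply: (@le_trans _ _ (C ^+ k * ((2 * d%:R ^+ 2) ^+ k * pint (f ^+ (2 * k))))).
  by apply: ler_wpM2l; [exact: exprn_ge0|exact: bernstein_cube].
rewrite mulrA -exprMn; apply: ler_wpM2r.
  rewrite -(mul0r (pint (0 : mpoly n R))) -pintZ; apply: le_pint => s _.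
  by rewrite scale0r /peval meval0 rmorphXn /= exprM exprn_ge0// sqr_ge0.
apply: lerXn2r; rewrite ?nnegrE ?mulr_ge0 ?exprn_ge0//.
have -> : 10 * k%:R ^+ 2 * d%:R ^+ 4 = (5 * (k * d)%:R ^+ 2) * (2 * d%:R ^+ 2) :> R.
  by rewrite natrM; ring.
apply: ler_wpM2r; first by rewrite mulr_ge0// exprn_ge0.
by apply: le5; rewrite exprn_ege1// ler1n.
Qed.
End markov.

(** * The inequalities between norms *)

Section norms.
Context (R : realType) (n : nat).
Local Notation T := (n.-tuple (measurableTypeR R)).

Lemma cube_LnormE k (h : T -> R) : (0 < k)%N ->
  cube_Lnorm k%:R%:E h =
  ((\int[lebesgue_tuple n]_(x in cube R n) (`|h x| ^+ k)%:E) `^ k%:R^-1)%E.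
Proof.
move=> k0; rewrite /cube_Lnorm unlock; congr (_ `^ _)%E.
rewrite [RHS]integral_mkcond; apply: eq_integral => x _.
rewrite !patchE; case: ifP => _ /=; first by rewrite powR_mulrn.
by rewrite normr0 powR0// pnatr_eq0 -lt0n.
Qed.

Lemma root_le (A B c : R) k : (0 < k)%N -> 0 <= A -> 0 <= B -> 0 <= c ->
  A <= c ^+ k * B -> A `^ k%:R^-1 <= c * B `^ k%:R^-1.
Proof.
move=> k0 A0 B0 c0 AB.
have k1 : k%:R != 0 :> R by rewrite pnatr_eq0 -lt0n.
have -> : c = (c ^+ k) `^ k%:R^-1.
  by rewrite -powR_mulrn// -powRrM mulfV// powRr1.
rewrite -powRM ?exprn_ge0//; apply: ge0_ler_powR => //.
by rewrite nnegrE mulr_ge0 ?exprn_ge0.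
Qed.
End norms.

Theorem theorem1p4 (R : realType) :
  exists C1 C2 : nat -> R,
    [/\ C1 1%N = Num.sqrt 2 /\ C2 1%N = 12,
        forall k : nat, (2 <= k)%N ->
          C1 k = 46 * k%:R ^+ 2 /\ C2 k = 368 * k%:R ^+ 3 &
        forall k : nat, (0 < k)%N ->
          [/\ 0 < C1 k, 0 < C2 k &
              forall (n d : nat) (f : mpoly n R),
                (0 < n)%N -> (0 < d)%N -> poly_space R d n f ->
                ((\int[lebesgue_tuple n]_(x in cube R n)
                     (weighted_sqgrad f x ^+ k)%:E) `^ ((2 * k)%:R)^-1
                 <= (C1 k * d%:R)%:E * cube_Lnorm (2 * k)%:R%:E (peval f))%E
                /\
                (cube_Lnorm (2 * k)%:R%:E (grad_norm f)
                 <= (C2 k * d%:R ^+ 2)%:E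
                    * cube_Lnorm (2 * k)%:R%:E (peval f))%E]].
Proof.
exists (fun k => if k == 1%N then Num.sqrt 2 else 46 * k%:R ^+ 2),
  (fun k => if k == 1%N then 12 else 368 * k%:R ^+ 3).
split => [//|k k2|k k0].
  by rewrite gtn_eqF.
have k1R : 1 <= k%:R :> R by rewrite ler1n.
set C1 := if _ then _ else _; set C2 := if _ then _ else _.
have [C1_gt0 C1_sqr] : 0 < C1 /\ 2 <= C1 ^+ 2.
  rewrite /C1; case: eqP => _; first by rewrite sqrtr_gt0 sqr_sqrtr// ltr0n lexx.
  have kk : 1 <= k%:R ^+ 2 :> R by rewrite exprn_ege1.
  split; first by lra.
  by rewrite expr2; nra.
have [C2_gt0 C2_sqr] : 0 < C2 /\ 10 * k%:R ^+ 2 <= C2 ^+ 2.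
  rewrite /C2; case: eqP => [->|_]; first by split; lra.
  have kk : 1 <= k%:R ^+ 3 :> R by rewrite exprn_ege1.
  split; first by lra.
  have -> : (368 * k%:R ^+ 3) ^+ 2 = (368 ^+ 2 * k%:R ^+ 4) * k%:R ^+ 2 :> R by ring.
  apply: ler_wpM2r; first exact: sqr_ge0.
  have : 1 <= k%:R ^+ 4 :> R by rewrite exprn_ege1.
  lra.
split => // n d f _ d0 fd.
have kk0 : (0 < 2 * k)%N by rewrite muln_gt0.
pose B := pint (f ^+ (2 * k)).
have intB : (\int[lebesgue_tuple n]_(x in cube R n) (`|peval f x| ^+ (2 * k))%:E)%E =
  B%:E.
  rewrite /B -cubeint_EFin; last exact: bm_peval.
  apply: eq_integral => x _; congr EFin.
  by rewrite /peval rmorphXn /= !exprM real_normK ?num_real.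
have B0 : 0 <= B by rewrite -lee_fin -intB; apply: integral_ge0 => x _;
  rewrite lee_fin exprn_ge0.
have intW : (\int[lebesgue_tuple n]_(x in cube R n) (weighted_sqgrad f x ^+ k)%:E)%E =
    (pint (wgrad_poly f ^+ k))%:E.
  rewrite -cubeint_EFin; last exact: bm_peval.
  by apply: eq_integral => x _; rewrite -peval_wgrad /peval rmorphXn.
have intF : (\int[lebesgue_tuple n]_(x in cube R n) (`|grad_norm f x| ^+ (2 *
  k))%:E)%E =
    (pint (sqgrad_poly f ^+ k))%:E.
  rewrite -cubeint_EFin; last exact: bm_peval.
  apply: eq_integral => x _; rewrite /peval rmorphXn /= meval_sqgrad exprM.
  rewrite real_normK ?num_real// /grad_norm sqr_sqrtr// sumr_ge0// => j _.
  exact: sqr_ge0.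
have W0 : 0 <= pint (wgrad_poly f ^+ k).
  rewrite -lee_fin -intW; apply: integral_ge0 => x xc; rewrite lee_fin exprn_ge0//.
  rewrite -peval_wgrad; apply: meval_wgrad_ge0 => i.
  by have := xc i; rewrite in_itv /= ler_norml.
have F0 : 0 <= pint (sqgrad_poly f ^+ k).
  by rewrite -lee_fin -intF; apply: integral_ge0 => x _; rewrite lee_fin exprn_ge0.
have NB : cube_Lnorm (2 * k)%:R%:E (peval f) = (B `^ (2 * k)%:R^-1)%:E.
  by rewrite (cube_LnormE _ kk0) intB poweR_EFin.
have NF : cube_Lnorm (2 * k)%:R%:E (grad_norm f) =
    (pint (sqgrad_poly f ^+ k) `^ (2 * k)%:R^-1)%:E.
  by rewrite (cube_LnormE _ kk0) intF poweR_EFin.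
rewrite NB NF intW poweR_EFin; split; rewrite -EFinM lee_fin.
  apply: root_le => //; first by rewrite mulr_ge0// ltW.
  apply: le_trans (bernstein_cube d0 k0 fd) _; rewrite -/B exprM;
    apply: ler_wpM2r => //.
  rewrite lerXn2r ?nnegrE ?sqr_ge0 ?mulr_ge0 ?exprn_ge0//.
  by rewrite exprMn ler_wpM2r// sqr_ge0.
apply: root_le => //; first by rewrite mulr_ge0 ?exprn_ge0// ltW.
apply: le_trans (markov_cube d0 k0 fd) _; rewrite -/B exprM; apply: ler_wpM2r => //.
rewrite lerXn2r ?nnegrE ?sqr_ge0 ?mulr_ge0 ?exprn_ge0//.
by rewrite exprMn -exprM ler_wpM2r// exprn_ge0.
Qed.
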